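(* Let $\varphi$ be a Jacob's ladder associated with $\mu(y)=7y\ln y$. Then, as $T\to\infty$, uniformly for $U\in\left(0,\frac{T}{\ln T}\right]$, $$\int_T^{T+U}Z^2(t)\,{\rm d}t=U\ln T\,\tan[\alpha(T,U)]\left\{1+\mathcal{O}\left(\frac{\ln\ln T}{\ln T}\right)\right\}.$$
   Context: Let $Z(t)=e^{i\vartheta(t)}\zeta(\tfrac12+it)$ be Hardy's function, where $\vartheta$ is the Riemann–Siegel theta function; $Z$ is real-valued and $Z^2(t)=|\zeta(\tfrac12+it)|^2$. Let $\mu(y)=7y\ln y$. A Jacob's ladder is a continuous, increasing, differentiable function $\varphi(T)$, defined for all sufficiently large $T$ with $\varphi(T)\to\infty$, which solves the nonlinear integral equation $$\int_0^{\mu[\varphi(T)]}Z^2(t)e^{-\frac{2}{\varphi(T)}t}\,{\rm d}t=\int_0^T Z^2(t)\,{\rm d}t.$$ For $T,U>0$ put $\tan[\alpha(T,U)]=\frac{\varphi(T+U)-\varphi(T)}{2U}$, the slope of the chord of the curve $y=\frac12\varphi(T)$ joining the points with abscissae $T$ and $T+U$. *)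

(* Defs.v *)
From Stdlib Require Import Reals Lra ClassicalEpsilon.
Open Scope R_scope.

(* Limit of a real sequence, chosen by Hilbert's epsilon (meaningful when it converges). *)
Definition seq_lim (u : nat -> R) : R :=
  epsilon (inhabits 0) (fun l => Un_cv u l).

(* Dirichlet eta function at s = 1/2 + i t:
   eta(s) = sum_{n>=1} (-1)^(n-1) n^(-s),  n^(-s) = n^(-1/2) (cos(t ln n) - i sin(t ln n)).
   The series converges for Re s > 0. *)
Definition eta_re_partial (t : R) (N : nat) : R :=
  sum_f_R0 (fun k => (-1) ^ k * / sqrt (INR (S k)) * cos (t * ln (INR (S k)))) N.
Definition eta_im_partial (t : R) (N : nat) : R :=
  sum_f_R0 (fun k => - ((-1) ^ k * / sqrt (INR (S k)) * sin (t * ln (INR (S k))))) N.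

Definition eta_re (t : R) : R := seq_lim (eta_re_partial t).
Definition eta_im (t : R) : R := seq_lim (eta_im_partial t).

(* |1 - 2^(1-s)|^2 at s = 1/2 + i t, where 2^(1-s) = sqrt 2 (cos(t ln 2) - i sin(t ln 2)). *)
Definition eta_factor_sq (t : R) : R :=
  (1 - sqrt 2 * cos (t * ln 2)) ^ 2 + (sqrt 2 * sin (t * ln 2)) ^ 2.

(* Z^2(t) = |zeta(1/2 + i t)|^2 = |eta(1/2+it)|^2 / |1 - 2^(1/2 - i t)|^2. *)
Definition Zsq (t : R) : R := (eta_re t ^ 2 + eta_im t ^ 2) / eta_factor_sq t.

(* Riemann integral of f over [a,b] (value independent of the integrability proof). *)
Definition Rint (f : R -> R) (a b : R) : R :=
  epsilon (inhabits 0) (fun I => exists pr : Riemann_integrable f a b, RiemannInt pr = I).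

Definition mu (y : R) : R := 7 * y * ln y.

Definition is_jacobs_ladder (phi : R -> R) : Prop :=
  exists T0 : R,
    (forall T, T0 < T -> exists l, derivable_pt_lim phi T l) /\
    (forall T1 T2, T0 < T1 -> T1 < T2 -> phi T1 < phi T2) /\
    (forall M, exists T1, forall T, T1 < T -> M < phi T) /\
    (forall T, T0 < T ->
       Rint (fun t => Zsq t * exp (- (2 / phi T) * t)) 0 (mu (phi T))
       = Rint Zsq 0 T).

Definition tan_alpha (phi : R -> R) (T U : R) : R := (phi (T + U) - phi T) / (2 * U).

(* Main.v *)
Require Import Defs.
From Stdlib Require Import Reals Lra Lia ClassicalEpsilon.
From Coquelicot Require Import Coquelicot.
Open Scope R_scope.

(** Put [F(y) = int_0^{mu(y)} Z^2(t) e^{-2t/y} dt], so that a Jacob's ladder satisfies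
    [F(phi(T)) = int_0^T Z^2]. By the mean value theorem [int_T^{T+U} Z^2 = F'(xi) (phi(T+U) - phi(T))]
    with [xi] between [phi(T)] and [phi(T+U)], and it suffices that [F'(y) = (ln y)/2 + O(1)] and
    [ln phi(T) = ln T + O(ln ln T)].

    Both follow from [int_0^X (X-t) Z^2(t) dt = (X^2/2) ln X + O(X^2)] by partial integration. For the
    latter, the discrete Kusmin-Landau argument, applied to the alternating series beyond [2N] and to
    [sum_{N<n<=2N} n^{-s}], gives [zeta(1/2+it) = sum_{n<=N} n^{-s} + O(sqrt N / (1+t))] for
    [0 <= t <= N]. The transform [(1 - cos(l X)) / l^2] of the weight [X - t] is nonnegative and at most
    [2 / l^2], so with [N] close to [X] the off-diagonal terms of the mean square of the Dirichlet
    polynomial contribute only [O(X^2)]. *)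

(** With a sharp cutoff the off-diagonal terms would carry only [1 / l], and their absolute values
    would sum to the order [X ln X] of the main term; the weight [X - t] gains a second factor
    [1 / l], which makes the sum harmless. The smoothed mean is enough because [F'(y)] sees [Z^2]
    only through the smooth weight [(2 / y^2) t e^{-2t/y}], up to an endpoint term. This weight
    lives at the scale [t ~ y], so [ln t] may be frozen at [ln y], and
    [int_0^oo t e^{-2t/y} dt = y^2 / 4] produces the factor [1/2] in [F'(y) = (ln y)/2 + O(1)]. The
    factor 7 of [mu] gives [e^{-2 mu(y)/y} = y^{-14}], whereas all quantities at the cutoff are
    bounded by smaller powers of [y], since [mu(y) <= y^3]. Locating [phi(T)] needs only
    [x <= int_0^x Z^2 <= C x ln x]. The logarithm lost there is the sole source of the [ln ln T] in
    the theorem; the slope of [F] contributes [O(1)]. *)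

(** * Points of the unit circle *)

Definition cis (x : R) : C := (cos x, sin x).

Lemma cis_plus (x y : R) : cis (x + y) = (cis x * cis y)%C.
Proof.
  unfold cis, Cmult; cbn.
  rewrite cos_plus, sin_plus; f_equal; ring.
Qed.

Lemma Cmod_sq (z : C) : Cmod z ^ 2 = fst z ^ 2 + snd z ^ 2.
Proof.
  unfold Cmod; rewrite pow2_sqrt; [reflexivity|].
  apply Rplus_le_le_0_compat; apply pow2_ge_0.
Qed.

Lemma Cmod_cis (x : R) : Cmod (cis x) = 1.
Proof.
  unfold Cmod, cis; cbn.
  replace (_ + _) with 1; [apply sqrt_1|].
  generalize (sin2_cos2 x); unfold Rsqr; lra.
Qed.

Lemma Cmod_le_sq (z : C) (a : R) : 0 <= a -> fst z ^ 2 + snd z ^ 2 <= a ^ 2 -> Cmod z <= a.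
Proof.
  intros Ha H. rewrite <- Cmod_sq in H.
  generalize (Cmod_ge_0 z); nra.
Qed.

Lemma sin_sq_le (x : R) : sin x ^ 2 <= x ^ 2.
Proof.
  assert (P : forall u, 0 < u -> sin u ^ 2 <= u ^ 2).
  { intros u Hu. destruct (Rle_lt_dec u 1).
    - assert (0 <= sin u) by (apply sin_ge_0; generalize PI2_1; lra).
      generalize (sin_lt_x u Hu); nra.
    - generalize (SIN_bound u); nra. }
  destruct (Rtotal_order x 0) as [H|[H|H]].
  - specialize (P (- x) ltac:(lra)). rewrite sin_neg in P. nra.
  - subst; rewrite sin_0; lra.
  - auto.
Qed.

Lemma one_minus_cos_le (x : R) : 1 - cos x <= x ^ 2 / 2.
Proof.
  replace (cos x) with (1 - 2 * sin (x / 2) ^ 2).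
  - generalize (sin_sq_le (x / 2)); lra.
  - replace x with (2 * (x / 2)) at 2 by field. rewrite cos_2a_sin; ring.
Qed.

(** A chord is no longer than its arc: the squared chord is [2 - 2 cos (x - y)]. *)
Lemma Cmod_cis_minus (x y : R) : Cmod (cis x - cis y) <= Rabs (x - y).
Proof.
  apply Cmod_le_sq; [apply Rabs_pos|].
  rewrite pow2_abs; unfold cis; cbn [fst snd Cminus Cplus Copp].
  generalize (one_minus_cos_le (x - y)); rewrite cos_minus.
  generalize (sin2_cos2 x) (sin2_cos2 y); unfold Rsqr; nra.
Qed.

(** * The discrete Kusmin-Landau inequality *)

Fixpoint csum (u : nat -> C) (n : nat) : C :=
  match n with O => 0%C | S m => (csum u m + u m)%C end.

Lemma csum_plus_idx (u : nat -> C) (K m : nat) :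
  csum u (K + m) = (csum u K + csum (fun k => u (K + k)%nat) m)%C.
Proof.
  induction m as [|m IH].
  - rewrite Nat.add_0_r; cbn; ring.
  - rewrite Nat.add_succ_r; cbn; rewrite IH; ring.
Qed.

Lemma csum_triangle (u : nat -> C) (b : R) (n : nat) :
  (forall k, (k < n)%nat -> Cmod (u k) <= b) -> Cmod (csum u n) <= INR n * b.
Proof.
  induction n as [|n IH]; intros H.
  - cbn [csum]; rewrite Cmod_0; cbn; lra.
  - cbn [csum]; rewrite S_INR.
    eapply Rle_trans; [apply Cmod_triangle|].
    specialize (IH ltac:(intros; apply H; lia)). specialize (H n ltac:(lia)). lra.
Qed.

(* Kusmin-Landau in discrete form: with [d k = 1 / (1 - r k)] one has
   [u k = (u k - u (k+1)) * d k], and Abel summation leaves only the variation of [d]. *)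
Lemma kusmin_landau (u r : nat -> C) (D : R) (W : nat -> R) (m : nat) :
  0 <= D ->
  (forall k, u (S k) = (r k * u k)%C) ->
  (forall k, Cmod (u (S k)) <= Cmod (u k)) ->
  (forall k, (k <= m)%nat -> 1 <= D * Cmod (1 - r k)) ->
  (forall k, (k < m)%nat -> Cmod (r (S k) - r k) <= W k - W (S k)) ->
  Cmod (csum u (S m)) <= Cmod (u O) * (2 * D + D ^ 2 * (W O - W m)).
Proof.
  intros HD Hu Hdec Hr HW.
  assert (Hmono : forall k, Cmod (u k) <= Cmod (u O)).
  { induction k; [lra|]. eapply Rle_trans; [apply Hdec|auto]. }
  assert (Hne : forall k, (k <= m)%nat -> (1 - r k)%C <> 0%C).
  { intros k Hk E. specialize (Hr k Hk). rewrite E, Cmod_0 in Hr. lra. }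
  assert (Hd : forall k, (k <= m)%nat -> Cmod (/ (1 - r k)) <= D).
  { intros k Hk. rewrite Cmod_inv by auto.
    specialize (Hr k Hk). assert (0 < Cmod (1 - r k)) by (apply Cmod_gt_0; auto).
    apply (Rmult_le_reg_l (Cmod (1 - r k))); [lra|].
    rewrite Rinv_r by lra. lra. }
  (* Adding the boundary term [u (j+1) * d j] turns the partial sum into [u 0 * d 0] plus the terms
     [u i * (d i - d (i-1))], and [d (j+1) - d j = (r (j+1) - r j) * d (j+1) * d j]. *)
  assert (Main : forall j, (j <= m)%nat ->
     Cmod (csum u (S j) + u (S j) * / (1 - r j)) <= Cmod (u O) * (D + D ^ 2 * (W O - W j))).
  { induction j as [|j IH]; intros Hj.
    - cbn [csum]. replace (0 + u O + u 1%nat * / (1 - r O))%C with (u O * / (1 - r O))%C.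
      2:{ rewrite Hu. field. auto. }
      rewrite Cmod_mult. specialize (Hd O Hj).
      generalize (Cmod_ge_0 (u O)); nra.
    - replace (csum u (S (S j)) + u (S (S j)) * / (1 - r (S j)))%C with
        ((csum u (S j) + u (S j) * / (1 - r j)) +
         u (S j) * ((r (S j) - r j) * (/ (1 - r (S j)) * / (1 - r j))))%C.
      2:{ cbn [csum]. rewrite (Hu (S j)). field. split; apply Hne; lia. }
      eapply Rle_trans; [apply Cmod_triangle|].
      specialize (IH ltac:(lia)).
      assert (B : Cmod (u (S j) * ((r (S j) - r j) * (/ (1 - r (S j)) * / (1 - r j))))
                  <= Cmod (u O) * ((W j - W (S j)) * (D * D))).
      { rewrite !Cmod_mult.
        apply Rmult_le_compat; try apply Cmod_ge_0; auto.
        - apply Rmult_le_pos; [|apply Rmult_le_pos]; apply Cmod_ge_0.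
        - apply Rmult_le_compat; try apply Cmod_ge_0.
          + apply Rmult_le_pos; apply Cmod_ge_0.
          + apply HW; lia.
          + apply Rmult_le_compat; try apply Cmod_ge_0; apply Hd; lia. }
      nra. }
  specialize (Main m ltac:(lia)).
  (* Removing the boundary term again costs the second [D]. *)
  replace (csum u (S m)) with ((csum u (S m) + u (S m) * / (1 - r m)) - u (S m) * / (1 - r m))%C by ring.
  eapply Rle_trans; [apply Cmod_triangle|].
  rewrite Cmod_opp, Cmod_mult.
  assert (Cmod (u (S m)) * Cmod (/ (1 - r m)) <= Cmod (u O) * D)
    by (apply Rmult_le_compat; try apply Cmod_ge_0; auto).
  nra.
Qed.

(** * Ratios of consecutive terms [n^(-s)] and their variation *)

Lemma ln_minus_bounds (x : R) : 0 < x -> / (x + 1) <= ln (x + 1) - ln x <= / x.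
Proof.
  assert (A : forall u, 0 < u -> ln u <= u - 1).
  { intros u Hu. generalize (exp_ineq1_le (ln u)). rewrite exp_ln by lra. lra. }
  intros Hx. split.
  - generalize (A (x / (x + 1)) ltac:(apply Rdiv_lt_0_compat; lra)).
    rewrite ln_div by lra. replace (x / (x + 1) - 1) with (- / (x + 1)) by (field; lra). lra.
  - generalize (A ((x + 1) / x) ltac:(apply Rdiv_lt_0_compat; lra)).
    rewrite ln_div by lra. replace ((x + 1) / x - 1) with (/ x) by (field; lra). lra.
Qed.

Lemma ln_minus_decr (x : R) : 0 < x -> ln (x + 1 + 1) - ln (x + 1) <= ln (x + 1) - ln x.
Proof.
  intros Hx. rewrite <- !ln_div by lra. apply ln_le.
  - apply Rdiv_lt_0_compat; lra.
  - apply (Rmult_le_reg_l (x * (x + 1))); [nra|].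
    replace (x * (x + 1) * ((x + 1 + 1) / (x + 1))) with (x * (x + 2)) by (field; lra).
    replace (x * (x + 1) * ((x + 1) / x)) with ((x + 1) * (x + 1)) by (field; lra).
    nra.
Qed.

Lemma sqrt_ratio_incr (x : R) : 0 < x -> sqrt (x / (x + 1)) <= sqrt ((x + 1) / (x + 1 + 1)).
Proof.
  intros Hx. apply sqrt_le_1_alt.
  apply (Rmult_le_reg_l ((x + 1) * (x + 1 + 1))); [nra|].
  replace ((x + 1) * (x + 1 + 1) * (x / (x + 1))) with (x * (x + 2)) by (field; lra).
  replace ((x + 1) * (x + 1 + 1) * ((x + 1) / (x + 1 + 1))) with ((x + 1) * (x + 1)) by (field; lra).
  nra.
Qed.

Lemma sqrt_ratio_bounds (x : R) : 0 < x -> 1 - / (x + 1) <= sqrt (x / (x + 1)) <= 1.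
Proof.
  intros Hx.
  assert (H : 0 < x / (x + 1)) by (apply Rdiv_lt_0_compat; lra).
  assert (E : x / (x + 1) = 1 - / (x + 1)) by (field; lra).
  assert (0 < / (x + 1)) by (apply Rinv_0_lt_compat; lra).
  assert (0 < sqrt (x / (x + 1))) by (apply sqrt_lt_R0; lra).
  generalize (sqrt_sqrt (x / (x + 1)) ltac:(lra)). rewrite <- E.
  split; nra.
Qed.

(** On [[0, 1]] the derivative [cos] is at least [1/2]. *)
Lemma half_le_sin (x : R) : 0 <= x <= 1 -> x / 2 <= sin x.
Proof.
  intros Hx. destruct (Req_dec x 0) as [->|Hn]; [rewrite sin_0; lra|].
  destruct (MVT_gen sin 0 x cos) as [c [Hc E]].
  - intros y _. apply is_derive_Reals, derivable_pt_lim_sin.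
  - intros y _. apply continuity_sin.
  - rewrite Rmin_left, Rmax_right in Hc by lra. rewrite sin_0 in E.
    generalize (one_minus_cos_le c); nra.
Qed.

(* [n ^ (- s)] at [s = 1/2 + i t], for [n >= 1] *)
Definition dir (t : R) (n : nat) : C := (RtoC (/ sqrt (INR n)) * cis (- (t * ln (INR n))))%C.

Definition dir_ratio (t : R) (n : nat) : C :=
  (RtoC (sqrt (INR n / INR (S n))) * cis (- (t * (ln (INR (S n)) - ln (INR n)))))%C.

(* Modulus and argument of [dir_ratio t n] are both monotone in [n], so that its increments are bounded
   by those of [ratio_var t], which telescope. *)
Definition ratio_var (t : R) (n : nat) : R :=
  - sqrt (INR n / INR (S n)) + Rabs t * (ln (INR (S n)) - ln (INR n)).

Lemma INR_S_pos (n : nat) : 0 < INR (S n).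
Proof. apply lt_0_INR; lia. Qed.

Lemma Cmod_dir (t : R) (n : nat) : (1 <= n)%nat -> Cmod (dir t n) = / sqrt (INR n).
Proof.
  intros Hn. unfold dir. rewrite Cmod_mult, Cmod_cis, Cmod_R, Rmult_1_r.
  apply Rabs_pos_eq, Rlt_le, Rinv_0_lt_compat, sqrt_lt_R0, lt_0_INR; lia.
Qed.

Lemma dir_S (t : R) (n : nat) : (1 <= n)%nat -> dir t (S n) = (dir_ratio t n * dir t n)%C.
Proof.
  intros Hn. unfold dir, dir_ratio.
  assert (H1 : 0 < INR n) by (apply lt_0_INR; lia).
  assert (H2 := INR_S_pos n).
  replace (- (t * ln (INR (S n)))) with
    (- (t * (ln (INR (S n)) - ln (INR n))) + - (t * ln (INR n))) by ring.
  rewrite cis_plus.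
  replace (/ sqrt (INR (S n))) with (sqrt (INR n / INR (S n)) * / sqrt (INR n)).
  - rewrite RtoC_mult; ring.
  - rewrite sqrt_div by lra. field.
    split; apply Rgt_not_eq, sqrt_lt_R0; lra.
Qed.

Lemma dir_ratio_increment (t : R) (n : nat) : (1 <= n)%nat ->
  Cmod (dir_ratio t (S n) - dir_ratio t n) <= ratio_var t n - ratio_var t (S n).
Proof.
  intros Hn. unfold dir_ratio, ratio_var.
  rewrite !S_INR. set (x := INR n).
  assert (Hx : 0 < x) by (apply lt_0_INR; lia).
  set (r := sqrt (x / (x + 1))). set (r' := sqrt ((x + 1) / (x + 1 + 1))).
  set (h := ln (x + 1) - ln x). set (h' := ln (x + 1 + 1) - ln (x + 1)).
  replace (r' * cis (- (t * h')) - r * cis (- (t * h)))%C with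
   (RtoC (r' - r) * cis (- (t * h')) + RtoC r * (cis (- (t * h')) - cis (- (t * h))))%C
   by (rewrite RtoC_minus; ring).
  eapply Rle_trans; [apply Cmod_triangle|].
  rewrite !Cmod_mult, !Cmod_R, Cmod_cis.
  assert (A := sqrt_ratio_incr x Hx). fold r r' in A.
  assert (B := ln_minus_decr x Hx). fold h h' in B.
  rewrite (Rabs_pos_eq (r' - r)) by lra.
  assert (Hr : 0 <= r <= 1) by (split; [apply sqrt_pos|apply sqrt_ratio_bounds; lra]).
  rewrite (Rabs_pos_eq r) by lra.
  assert (Q := Cmod_cis_minus (- (t * h')) (- (t * h))).
  replace (- (t * h') - - (t * h)) with (t * (h - h')) in Q by ring.
  rewrite Rabs_mult, (Rabs_pos_eq (h - h')) in Q by lra.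
  generalize (Cmod_ge_0 (cis (- (t * h')) - cis (- (t * h)))); nra.
Qed.

(** The modulus accounts for at most [1 / (n + 1)], the argument for at most [|t| / n]. The bound
    does not depend on the length of the block. *)
Lemma ratio_var_minus (t : R) (n m : nat) : (1 <= n)%nat -> (1 <= m)%nat ->
  ratio_var t n - ratio_var t m <= (1 + Rabs t) / INR n.
Proof.
  intros Hn Hm. unfold ratio_var. rewrite !S_INR.
  assert (Hx : 0 < INR n) by (apply lt_0_INR; lia).
  assert (Hy : 0 < INR m) by (apply lt_0_INR; lia).
  generalize (sqrt_ratio_bounds _ Hx) (sqrt_ratio_bounds _ Hy)
    (ln_minus_bounds _ Hx) (ln_minus_bounds _ Hy) (Rabs_pos t).
  assert (/ (INR n + 1) <= / INR n) by (apply Rinv_le_contravar; lra).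
  assert (0 < / (INR m + 1)) by (apply Rinv_0_lt_compat; lra).
  unfold Rdiv; nra.
Qed.

(** * The eta series: tails, convergence, continuity in [t] *)

Definition eta_term (t : R) (k : nat) : C := (RtoC ((-1) ^ k) * dir t (S k))%C.

Lemma Cmod_eta_term (t : R) (k : nat) : Cmod (eta_term t k) = / sqrt (INR (S k)).
Proof.
  unfold eta_term. rewrite Cmod_mult, Cmod_R, pow_1_abs, Cmod_dir by lia. ring.
Qed.

Lemma inv_sqrt_decr (n m : nat) : (1 <= n)%nat -> (n <= m)%nat -> / sqrt (INR m) <= / sqrt (INR n).
Proof.
  intros Hn Hm. apply Rinv_le_contravar.
  - apply sqrt_lt_R0, lt_0_INR; lia.
  - apply sqrt_le_1_alt, le_INR; lia.
Qed.

(** The alternating sign makes the ratio [- dir_ratio]. Beyond [|t|] the phase of [dir_ratio] is at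
    most 1, so its real part is nonnegative and [1 + dir_ratio] has modulus at least 1:
    Kusmin-Landau applies with [D = 1], and the variation is at most 2. *)
Lemma eta_block_bound (t : R) (K m : nat) : Rabs t <= INR (S K) ->
  Cmod (csum (fun k => eta_term t (K + k)) m) <= 4 / sqrt (INR (S K)).
Proof.
  intros Ht.
  assert (HK := INR_S_pos K).
  assert (HsK : 0 < / sqrt (INR (S K))) by (apply Rinv_0_lt_compat, sqrt_lt_R0; lra).
  destruct m as [|m].
  { cbn [csum]. rewrite Cmod_0. unfold Rdiv. lra. }
  eapply Rle_trans.
  - apply (kusmin_landau _ (fun k => - dir_ratio t (S (K + k)))%C 1 (fun k => ratio_var t (S (K + k)))).
    + lra.
    + intros k. unfold eta_term. rewrite Nat.add_succ_r.
      rewrite (dir_S t (S (K + k))) by lia. cbn [pow]. rewrite RtoC_mult.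
      replace (RtoC (-1)) with (- RtoC 1)%C by (rewrite <- RtoC_opp; reflexivity). ring.
    + intros k. rewrite !Cmod_eta_term. apply inv_sqrt_decr; lia.
    + intros k _. rewrite Rmult_1_l.
      eapply Rle_trans; [|apply re_le_Cmod].
      unfold dir_ratio, cis, Re, Cminus, Copp, Cmult, Cplus, RtoC; cbn [fst snd].
      set (n := S (K + k)).
      assert (Hn : 0 < INR n) by apply INR_S_pos.
      assert (HKn : INR (S K) <= INR n) by (apply le_INR; unfold n; lia).
      assert (0 <= sqrt (INR n / INR (S n))) by apply sqrt_pos.
      assert (0 <= cos (- (t * (ln (INR (S n)) - ln (INR n))))).
      { rewrite S_INR. set (h := ln (INR n + 1) - ln (INR n)).
        assert (0 <= h <= / INR n).
        { generalize (ln_minus_bounds _ Hn). fold h.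
          assert (0 < / (INR n + 1)) by (apply Rinv_0_lt_compat; lra). lra. }
        assert (Rabs (t * h) <= 1).
        { rewrite Rabs_mult, (Rabs_pos_eq h) by lra.
          generalize (Rabs_pos t); intros.
          assert (INR n * / INR n = 1) by (field; lra). nra. }
        generalize (one_minus_cos_le (- (t * h))).
        rewrite <- (pow2_abs (- (t * h))), Rabs_Ropp.
        generalize (Rabs_pos (t * h)); nra. }
      rewrite Rabs_pos_eq; nra.
    + intros k _. rewrite Nat.add_succ_r.
      replace (- dir_ratio t (S (S (K + k))) - - dir_ratio t (S (K + k)))%C
        with (- (dir_ratio t (S (S (K + k))) - dir_ratio t (S (K + k))))%C by ring.
      rewrite Cmod_opp. apply dir_ratio_increment; lia.
  - cbv beta. rewrite Cmod_eta_term, Nat.add_0_r.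
    assert (A := ratio_var_minus t (S K) (S (K + m)) ltac:(lia) ltac:(lia)).
    assert ((1 + Rabs t) / INR (S K) <= 2).
    { apply (Rmult_le_reg_r (INR (S K))); [lra|]. unfold Rdiv.
      rewrite Rmult_assoc, Rinv_l by lra.
      assert (1 <= INR (S K)) by (apply (le_INR 1); lia). lra. }
    unfold Rdiv. nra.
Qed.

(** Without signs the ratio is close to 1, but for [N < n <= 2N] its phase lies between [t / (3N)]
    and 1. This allows [D = 12 N / t], and both [D] and [D^2 (1 + t) / N] are of order [N / t]. For
    [t < 1] the trivial bound [sqrt N] is enough. *)
Lemma dir_block_bound (t : R) (N : nat) : (1 <= N)%nat -> 0 <= t <= INR N ->
  Cmod (csum (fun k => dir t (S (N + k))) N) <= 624 * sqrt (INR N) / (1 + t).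
Proof.
  intros HN Ht.
  assert (HN1 : 1 <= INR N) by (apply (le_INR 1); lia).
  assert (HsN : 0 < sqrt (INR N)) by (apply sqrt_lt_R0; lra).
  assert (HNs : sqrt (INR N) * sqrt (INR N) = INR N) by (apply sqrt_sqrt; lra).
  assert (Hi : / sqrt (INR N) * INR N = sqrt (INR N)).
  { rewrite <- HNs at 2. field. lra. }
  assert (Hi0 : 0 < / sqrt (INR N)) by (apply Rinv_0_lt_compat; lra).
  destruct (Rle_lt_dec 1 t) as [H1|H1].
  - set (x := INR N) in *.
    assert (Hb : Cmod (csum (fun k => dir t (S (N + k))) N) <=
       / sqrt x * (2 * (12 * x / t) + (12 * x / t) ^ 2 * ((1 + t) / x))).
    { destruct N as [|m]; [lia|].
      eapply Rle_trans.
      - apply (kusmin_landau _ (fun k => dir_ratio t (S (S m + k))) (12 * x / t)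
                 (fun k => ratio_var t (S (S m + k)))).
        + apply Rmult_le_pos; [lra|apply Rlt_le, Rinv_0_lt_compat; lra].
        + intros k. rewrite Nat.add_succ_r. apply dir_S. lia.
        + intros k. rewrite !Cmod_dir by lia. apply inv_sqrt_decr; lia.
        + intros k Hk.
          assert (L : t / (12 * x) <= Cmod (1 - dir_ratio t (S (S m + k)))).
          (* The imaginary part alone suffices: modulus at least [1/2], sine at least half the
             phase, phase at least [t / (3N)]. *)
          { eapply Rle_trans; [|apply Rle_trans with (2 := Rmax_Cmod _), Rmax_r].
            unfold dir_ratio, cis, Cminus, Copp, Cmult, Cplus, RtoC; cbn [fst snd].
            set (n := S (S m + k)).
            assert (Hn : 0 < INR n) by apply INR_S_pos.
            assert (Hn1 : x <= INR n) by (apply le_INR; unfold n; lia).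
            assert (Hn2 : INR n <= 2 * x).
            { unfold x. replace 2 with (INR 2) by reflexivity. rewrite <- mult_INR.
              apply le_INR; unfold n; lia. }
            rewrite S_INR, sin_neg. set (h := ln (INR n + 1) - ln (INR n)).
            assert (Hh := ln_minus_bounds _ Hn). fold h in Hh.
            set (r := sqrt (INR n / (INR n + 1))).
            assert (Hr : / 2 <= r).
            { generalize (sqrt_ratio_bounds _ Hn). fold r.
              assert (/ (INR n + 1) <= / 2) by (apply Rinv_le_contravar; lra). lra. }
            assert (Hl : t / (3 * x) <= t * h).
            { apply Rmult_le_compat_l; [lra|]. eapply Rle_trans; [|apply Hh].
              apply Rinv_le_contravar; lra. }
            assert (Hu : t * h <= 1).
            { assert (INR n * / INR n = 1) by (field; lra).
              assert (0 < / INR n) by (apply Rinv_0_lt_compat; lra). nra. }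
            assert (0 < t / (3 * x)) by (apply Rdiv_lt_0_compat; lra).
            assert (Hs := half_le_sin (t * h) ltac:(lra)).
            replace (t / (12 * x)) with (/ 2 * (t / (3 * x) / 2)) by (field; lra).
            rewrite Rabs_pos_eq; nra. }
          apply Rle_trans with (12 * x / t * (t / (12 * x))).
          * right; field; lra.
          * apply Rmult_le_compat_l; [|exact L].
            apply Rmult_le_pos; [lra|apply Rlt_le, Rinv_0_lt_compat; lra].
        + intros k _. rewrite Nat.add_succ_r. apply dir_ratio_increment; lia.
      - cbv beta. rewrite Nat.add_0_r, Cmod_dir by lia.
        assert (A := ratio_var_minus t (S (S m)) (S (S m + m)) ltac:(lia) ltac:(lia)).
        rewrite (Rabs_pos_eq t) in A by lra.
        assert (B : (1 + t) / INR (S (S m)) <= (1 + t) / x).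
        { apply Rmult_le_compat_l; [lra|]. apply Rinv_le_contravar; [lra|].
          apply le_INR; lia. }
        assert (C : / sqrt (INR (S (S m))) <= / sqrt x) by (apply inv_sqrt_decr; lia).
        assert (0 < / sqrt (INR (S (S m)))) by apply Rinv_0_lt_compat, sqrt_lt_R0, INR_S_pos.
        assert (0 < 12 * x / t) by (apply Rdiv_lt_0_compat; lra).
        assert (0 < (1 + t) / x) by (apply Rdiv_lt_0_compat; lra).
        apply Rle_trans with (/ sqrt (INR (S (S m))) *
          (2 * (12 * x / t) + (12 * x / t) ^ 2 * ((1 + t) / x))).
        + apply Rmult_le_compat_l; [lra|]. apply Rplus_le_compat_l, Rmult_le_compat_l; [|lra].
          apply pow2_ge_0.
        + apply Rmult_le_compat_r; [|exact C].
          assert (0 < (12 * x / t) ^ 2) by (apply pow_lt; lra). nra. }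
    eapply Rle_trans; [exact Hb|].
    replace (/ sqrt x * (2 * (12 * x / t) + (12 * x / t) ^ 2 * ((1 + t) / x)))
      with ((/ sqrt x * x) * (24 / t + 144 / t / t * (1 + t))) by (field; lra).
    rewrite Hi. unfold Rdiv at 4. rewrite (Rmult_comm 624), Rmult_assoc.
    apply Rmult_le_compat_l; [lra|].
    (* From [1 + t <= 2 t] one gets [(24 t + 144 (1 + t)) (1 + t) <= 312 t * 2 t], the origin of
       624. *)
    apply (Rmult_le_reg_r (t * t * (1 + t))); [nra|].
    replace ((24 / t + 144 / t / t * (1 + t)) * (t * t * (1 + t)))
      with ((24 * t + 144 * (1 + t)) * (1 + t)) by (field; lra).
    replace (624 * / (1 + t) * (t * t * (1 + t))) with (624 * (t * t)) by (field; lra).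
    nra.
  - eapply Rle_trans.
    + apply (csum_triangle _ (/ sqrt (INR N))). intros k _.
      rewrite Cmod_dir by lia. apply inv_sqrt_decr; lia.
    + rewrite Rmult_comm, Hi. apply (Rmult_le_reg_r (1 + t)); [lra|].
      unfold Rdiv. rewrite Rmult_assoc, Rinv_l by lra. nra.
Qed.

Lemma Cmod_le_abs (z : C) : Cmod z <= Rabs (fst z) + Rabs (snd z).
Proof.
  apply Cmod_le_sq.
  - generalize (Rabs_pos (fst z)) (Rabs_pos (snd z)); lra.
  - rewrite <- (pow2_abs (fst z)), <- (pow2_abs (snd z)).
    generalize (Rabs_pos (fst z)) (Rabs_pos (snd z)); nra.
Qed.

Lemma fst_le_Cmod (z : C) : Rabs (fst z) <= Cmod z.
Proof. eapply Rle_trans; [apply Rmax_l|apply Rmax_Cmod]. Qed.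

Lemma snd_le_Cmod (z : C) : Rabs (snd z) <= Cmod z.
Proof. eapply Rle_trans; [apply Rmax_r|apply Rmax_Cmod]. Qed.

Lemma eta_term_re (t : R) (k : nat) :
  fst (eta_term t k) = (-1) ^ k * / sqrt (INR (S k)) * cos (t * ln (INR (S k))).
Proof.
  unfold eta_term, dir, cis, Cmult, RtoC; cbn [fst snd]. rewrite cos_neg; ring.
Qed.

Lemma eta_term_im (t : R) (k : nat) :
  snd (eta_term t k) = - ((-1) ^ k * / sqrt (INR (S k)) * sin (t * ln (INR (S k)))).
Proof.
  unfold eta_term, dir, cis, Cmult, RtoC; cbn [fst snd]. rewrite sin_neg; ring.
Qed.

Lemma eta_re_partial_csum (t : R) (n : nat) : eta_re_partial t n = fst (csum (eta_term t) (S n)).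
Proof.
  induction n as [|n IH].
  - cbn [csum]. unfold eta_re_partial, Cplus; cbn [fst sum_f_R0].
    rewrite eta_term_re; cbn [fst RtoC]; ring.
  - change (csum (eta_term t) (S (S n))) with (csum (eta_term t) (S n) + eta_term t (S n))%C.
    unfold Cplus; cbn [fst]. rewrite <- IH, eta_term_re. reflexivity.
Qed.

Lemma eta_im_partial_csum (t : R) (n : nat) : eta_im_partial t n = snd (csum (eta_term t) (S n)).
Proof.
  induction n as [|n IH].
  - cbn [csum]. unfold eta_im_partial, Cplus; cbn [snd sum_f_R0].
    rewrite eta_term_im; cbn [snd RtoC]; ring.
  - change (csum (eta_term t) (S (S n))) with (csum (eta_term t) (S n) + eta_term t (S n))%C.
    unfold Cplus; cbn [snd]. rewrite <- IH, eta_term_im. reflexivity.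
Qed.

Lemma inv_sqrt_small (a e : R) : 0 < e -> exists K, forall n, (K <= n)%nat ->
  a <= INR n /\ 4 / sqrt (INR (S n)) < e.
Proof.
  intros He. destruct (INR_unbounded (Rmax a ((4 / e) ^ 2))) as [K HK].
  exists K. intros n Hn. assert (Hn' := le_INR _ _ Hn).
  generalize (Rmax_l a ((4 / e) ^ 2)) (Rmax_r a ((4 / e) ^ 2)); intros H1 H2.
  split; [lra|].
  assert (Hs := INR_S_pos n).
  assert (Hs' : 0 < sqrt (INR (S n))) by (apply sqrt_lt_R0; lra).
  assert (H4 : 0 < 4 / e) by (apply Rdiv_lt_0_compat; lra).
  assert (L : 4 / e < sqrt (INR (S n))).
  { rewrite <- (sqrt_pow2 (4 / e)) by lra. apply sqrt_lt_1_alt.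
    split; [apply pow2_ge_0|]. rewrite S_INR; lra. }
  apply (Rmult_lt_reg_r (sqrt (INR (S n)))); [lra|].
  unfold Rdiv at 1. rewrite Rmult_assoc, Rinv_l by lra.
  apply (Rmult_lt_compat_l e) in L; [|lra].
  replace (e * (4 / e)) with 4 in L by (field; lra). lra.
Qed.

Lemma eta_partial_diff (t : R) (K n : nat) : Rabs t <= INR (S K) -> (K <= n)%nat ->
  Cmod (csum (eta_term t) n - csum (eta_term t) K) <= 4 / sqrt (INR (S K)).
Proof.
  intros Ht Hn. replace n with (K + (n - K))%nat by lia.
  rewrite csum_plus_idx.
  match goal with |- Cmod (?a + ?b - ?a)%C <= _ => replace (a + b - a)%C with b by ring end.
  now apply eta_block_bound.
Qed.

(** The projection [p] is a parameter so that one proof serves the real and the imaginary part. *)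
Lemma eta_cauchy (p : C -> R) (t : R) : (forall z, Rabs (p z) <= Cmod z) ->
  (forall z w, p (z - w)%C = p z - p w) ->
  exists l, Un_cv (fun n => p (csum (eta_term t) (S n))) l.
Proof.
  intros Hp Hm. destruct (Rcomplete.R_complete (fun n => p (csum (eta_term t) (S n)))) as [l Hl].
  - intros e He. destruct (inv_sqrt_small (Rabs t) (e / 2) ltac:(lra)) as [K HK].
    exists K. intros n m Hn Hm'.
    destruct (HK K (Nat.le_refl _)) as [H1 H2].
    assert (HK1 : Rabs t <= INR (S K)) by (rewrite S_INR; lra).
    assert (A := eta_partial_diff t K (S n) HK1 ltac:(lia)).
    assert (B := eta_partial_diff t K (S m) HK1 ltac:(lia)).
    apply (Rle_trans _ _ _ (Hp _)) in A. apply (Rle_trans _ _ _ (Hp _)) in B.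
    rewrite Hm in A, B. unfold Rdist.
    apply Rabs_le_between in A, B. apply Rabs_def1; lra.
  - now exists l.
Qed.

Definition eta (t : R) : C := (eta_re t, eta_im t).

(** Existence of the limit is what gives the epsilon in [seq_lim] its meaning. *)
Lemma eta_re_cv (t : R) : Un_cv (fun n => fst (csum (eta_term t) (S n))) (eta_re t).
Proof.
  destruct (eta_cauchy fst t) as [l Hl]; [apply fst_le_Cmod|reflexivity|].
  unfold eta_re, seq_lim.
  apply Un_cv_ext with (eta_re_partial t); [apply eta_re_partial_csum|].
  apply epsilon_spec. exists l.
  apply Un_cv_ext with (2 := Hl). intros n; symmetry; apply eta_re_partial_csum.
Qed.

Lemma eta_im_cv (t : R) : Un_cv (fun n => snd (csum (eta_term t) (S n))) (eta_im t).
Proof.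
  destruct (eta_cauchy snd t) as [l Hl]; [apply snd_le_Cmod|reflexivity|].
  unfold eta_im, seq_lim.
  apply Un_cv_ext with (eta_im_partial t); [apply eta_im_partial_csum|].
  apply epsilon_spec. exists l.
  apply Un_cv_ext with (2 := Hl). intros n; symmetry; apply eta_im_partial_csum.
Qed.

Lemma eta_approx (t : R) (K : nat) : Rabs t <= INR (S K) ->
  Cmod (eta t - csum (eta_term t) K) <= 4 / sqrt (INR (S K)).
Proof.
  intros Ht. apply le_epsilon. intros e He.
  destruct (eta_re_cv t (e / 2) ltac:(lra)) as [N1 H1].
  destruct (eta_im_cv t (e / 2) ltac:(lra)) as [N2 H2].
  set (n := (N1 + N2 + K)%nat).
  specialize (H1 n ltac:(lia)). specialize (H2 n ltac:(lia)).
  assert (A := eta_partial_diff t K (S n) Ht ltac:(lia)).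
  set (z := csum (eta_term t) (S n)) in *.
  replace (eta t - csum (eta_term t) K)%C with
    ((z - csum (eta_term t) K) + (eta t - z))%C by ring.
  eapply Rle_trans; [apply Cmod_triangle|].
  apply Rplus_le_compat; [exact A|].
  eapply Rle_trans; [apply Cmod_le_abs|].
  unfold eta, Cminus, Cplus, Copp; cbn [fst snd].
  unfold Rdist in H1, H2. rewrite Rabs_minus_sym in H1, H2. unfold Rminus in H1, H2. lra.
Qed.

Lemma csum_eta_continuity (n : nat) (t : R) :
  continuity_pt (fun x => fst (csum (eta_term x) n)) t /\
  continuity_pt (fun x => snd (csum (eta_term x) n)) t.
Proof.
  induction n as [|n [IH1 IH2]].
  - split; apply continuity_pt_const; intros x y; reflexivity.
  - split.
    + apply (continuity_pt_ext (fun x => fst (csum (eta_term x) n) +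
        (-1) ^ n * / sqrt (INR (S n)) * cos (x * ln (INR (S n))))).
      { intros x. rewrite <- eta_term_re. reflexivity. }
      apply (continuity_pt_plus (fun x => fst (csum (eta_term x) n))); [exact IH1|reg].
    + apply (continuity_pt_ext (fun x => snd (csum (eta_term x) n) +
        - ((-1) ^ n * / sqrt (INR (S n)) * sin (x * ln (INR (S n)))))).
      { intros x. rewrite <- eta_term_im. reflexivity. }
      apply (continuity_pt_plus (fun x => snd (csum (eta_term x) n))); [exact IH2|reg].
Qed.

(** The tail bound depends on the point only through [|y| <= K + 1], hence is uniform near [t], and
    a uniform limit of continuous functions is continuous. *)
Lemma eta_continuity (t : R) : continuity_pt eta_re t /\ continuity_pt eta_im t.
Proof.
  assert (U : forall (e : R), 0 < e -> exists N, forall n y, (N <= n)%nat -> Boule t (mkposreal 1 Rlt_0_1) y ->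
     Cmod (eta y - csum (eta_term y) n) < e).
  { intros e He. destruct (inv_sqrt_small (Rabs t + 1) e He) as [K HK].
    exists K. intros n y Hn Hy. destruct (HK n Hn) as [H1 H2].
    eapply Rle_lt_trans; [apply eta_approx|exact H2].
    unfold Boule in Hy; cbn in Hy. rewrite S_INR.
    replace y with (t + (y - t)) by ring. generalize (Rabs_triang t (y - t)); lra. }
  assert (B : Boule t (mkposreal 1 Rlt_0_1) t).
  { unfold Boule; cbn. rewrite Rminus_diag, Rabs_R0; lra. }
  split.
  - eapply (CVU_continuity (fun n x => fst (csum (eta_term x) n))); [| |exact B].
    + intros e He. destruct (U e He) as [N HN]. exists N. intros n y Hn Hy.
      eapply Rle_lt_trans; [|apply (HN n y Hn Hy)].
      exact (fst_le_Cmod (eta y - csum (eta_term y) n)%C).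
    + intros n y _. apply csum_eta_continuity.
  - eapply (CVU_continuity (fun n x => snd (csum (eta_term x) n))); [| |exact B].
    + intros e He. destruct (U e He) as [N HN]. exists N. intros n y Hn Hy.
      eapply Rle_lt_trans; [|apply (HN n y Hn Hy)].
      exact (snd_le_Cmod (eta y - csum (eta_term y) n)%C).
    + intros n y _. apply csum_eta_continuity.
Qed.

(** * From eta to zeta: approximation by a Dirichlet polynomial *)

Definition eta_factor (t : R) : C := (1 - RtoC (sqrt 2) * cis (- (t * ln 2)))%C.

Lemma Cmod_eta_factor (t : R) : Cmod (eta_factor t) ^ 2 = eta_factor_sq t.
Proof.
  rewrite Cmod_sq. unfold eta_factor, eta_factor_sq, cis, Cminus, Cplus, Copp, Cmult, RtoC; cbn [fst snd].
  rewrite cos_neg, sin_neg. ring.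
Qed.

(** The subtracted number has modulus [sqrt 2], so its distance from 1 is at least [sqrt 2 - 1]. In
    squared form, [3 - 2 sqrt 2 > 3 - 2.84 > 1/16]. *)
Lemma eta_factor_lb (t : R) : / 4 <= Cmod (eta_factor t).
Proof.
  assert (H : / 16 <= Cmod (eta_factor t) ^ 2).
  { rewrite Cmod_eta_factor. unfold eta_factor_sq.
    assert (S2 : sqrt 2 * sqrt 2 = 2) by (apply sqrt_sqrt; lra).
    assert (0 < sqrt 2) by (apply sqrt_lt_R0; lra).
    assert (sqrt 2 < 1.42) by nra.
    generalize (sin2_cos2 (t * ln 2)) (COS_bound (t * ln 2)); unfold Rsqr; intros E Hc.
    replace ((1 - sqrt 2 * cos (t * ln 2)) ^ 2 + (sqrt 2 * sin (t * ln 2)) ^ 2)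
      with (1 - 2 * sqrt 2 * cos (t * ln 2) + (sqrt 2 * sqrt 2) *
         (sin (t * ln 2) * sin (t * ln 2) + cos (t * ln 2) * cos (t * ln 2))) by ring.
    rewrite E, S2. nra. }
  generalize (Cmod_ge_0 (eta_factor t)); nra.
Qed.

Lemma eta_factor_neq_0 (t : R) : eta_factor t <> 0%C.
Proof.
  intros E. generalize (eta_factor_lb t). rewrite E, Cmod_0. lra.
Qed.

(** The value of the zeta function at [1/2 + i t], through [eta(s) = (1 - 2^(1-s)) zeta(s)]. *)
Definition zeta (t : R) : C := (eta t / eta_factor t)%C.

Lemma Zsq_zeta (t : R) : Zsq t = Cmod (zeta t) ^ 2.
Proof.
  unfold Zsq, zeta. rewrite Cmod_div by apply eta_factor_neq_0.
  unfold Rdiv. rewrite Rpow_mult_distr, pow_inv, Cmod_eta_factor, Cmod_sq. reflexivity.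
Qed.

Lemma Zsq_nonneg (t : R) : 0 <= Zsq t.
Proof. rewrite Zsq_zeta. apply pow2_ge_0. Qed.

Lemma Zsq_continuity (t : R) : continuity_pt Zsq t.
Proof.
  destruct (eta_continuity t) as [H1 H2].
  unfold Zsq.
  apply (continuity_pt_div (fun x => eta_re x ^ 2 + eta_im x ^ 2) eta_factor_sq).
  - apply (continuity_pt_plus (fun x => eta_re x ^ 2) (fun x => eta_im x ^ 2)).
    + apply (continuity_pt_comp eta_re (fun u => u ^ 2)); [exact H1|reg].
    + apply (continuity_pt_comp eta_im (fun u => u ^ 2)); [exact H2|reg].
  - unfold eta_factor_sq. reg.
  - rewrite <- Cmod_eta_factor. generalize (eta_factor_lb t); nra.
Qed.

Definition dir_sum (t : R) (N : nat) : C := csum (fun k => dir t (S k)) N.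

Lemma dir_double (t : R) (n : nat) : (1 <= n)%nat ->
  dir t (2 * n) = (RtoC (/ sqrt 2) * cis (- (t * ln 2)) * dir t n)%C.
Proof.
  intros Hn. assert (Hn0 : 0 < INR n) by (apply lt_0_INR; lia).
  unfold dir. rewrite mult_INR. change (INR 2) with 2.
  rewrite ln_mult, sqrt_mult by lra.
  replace (- (t * (ln 2 + ln (INR n)))) with (- (t * ln 2) + - (t * ln (INR n))) by ring.
  rewrite cis_plus, Rinv_mult, RtoC_mult. ring.
Qed.

(** The alternating sum up to [2N] is the plain sum minus twice its even terms, and these make up
    [2^(-s)] times the plain sum up to [N]. Splitting the plain sum at [N] leaves the factor
    [1 - 2^(1-s)]. *)
Lemma csum_eta_double (t : R) (N : nat) :
  csum (eta_term t) (2 * N) =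
  (eta_factor t * dir_sum t N + csum (fun k => dir t (S (N + k))) N)%C.
Proof.
  assert (H : csum (eta_term t) (2 * N) =
    (dir_sum t (2 * N) - RtoC (sqrt 2) * cis (- (t * ln 2)) * dir_sum t N)%C).
  { induction N as [|N IH].
    - cbn. ring.
    - replace (2 * S N)%nat with (S (S (2 * N))) by lia.
      unfold dir_sum in *. cbn [csum]. rewrite IH. unfold eta_term.
      replace (S (S (2 * N))) with (2 * S N)%nat by lia.
      rewrite dir_double by lia.
      rewrite pow_1_even, pow_1_odd.
      replace (RtoC (-1)) with (- RtoC 1)%C by (rewrite <- RtoC_opp; reflexivity).
      replace (RtoC (/ sqrt 2)) with (RtoC (sqrt 2) * / RtoC 2)%C.
      2:{ rewrite <- RtoC_inv by lra. rewrite <- RtoC_mult. f_equal.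
          assert (0 < sqrt 2) by (apply sqrt_lt_R0; lra).
          apply (Rmult_eq_reg_l (sqrt 2)); [|lra].
          rewrite Rinv_r, <- Rmult_assoc, sqrt_sqrt by lra. field. }
      field. }
  rewrite H. unfold dir_sum, eta_factor. replace (2 * N)%nat with (N + N)%nat by lia.
  rewrite csum_plus_idx. ring.
Qed.

(** Multiplied by [eta_factor], the error is the eta tail beyond [2N] plus the block from [N] to
    [2N]. The constant is [4 * (8 + 624)], the 4 coming from [eta_factor_lb]. *)
Lemma zeta_approx (t : R) (N : nat) : (1 <= N)%nat -> 0 <= t <= INR N ->
  Cmod (zeta t - dir_sum t N) <= 2528 * sqrt (INR N) / (1 + t).
Proof.
  intros HN Ht.
  assert (HN1 : 1 <= INR N) by (apply (le_INR 1); lia).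
  assert (A := eta_approx t (2 * N)). rewrite Rabs_pos_eq in A by lra.
  assert (HNN : INR N <= INR (S (2 * N))) by (apply le_INR; lia).
  specialize (A ltac:(lra)). rewrite csum_eta_double in A.
  assert (B := dir_block_bound t N HN Ht).
  set (q := csum (fun k => dir t (S (N + k))) N) in *.
  replace (zeta t - dir_sum t N)%C with
    (((eta t - (eta_factor t * dir_sum t N + q)) + q) / eta_factor t)%C
    by (unfold zeta; field; apply eta_factor_neq_0).
  rewrite Cmod_div by apply eta_factor_neq_0.
  assert (F := eta_factor_lb t).
  apply (Rmult_le_reg_r (Cmod (eta_factor t))); [lra|].
  unfold Rdiv at 1. rewrite Rmult_assoc, Rinv_l, Rmult_1_r by lra.
  eapply Rle_trans; [apply Cmod_triangle|].
  assert (HsN : 0 < sqrt (INR N)) by (apply sqrt_lt_R0; lra).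
  assert (E : 4 / sqrt (INR (S (2 * N))) <= 8 * sqrt (INR N) / (1 + t)).
  { apply Rle_trans with (4 / sqrt (INR N)).
    - apply Rmult_le_compat_l; [lra|]. apply inv_sqrt_decr; lia.
    - apply (Rmult_le_reg_r (sqrt (INR N) * (1 + t))); [nra|].
      replace (4 / sqrt (INR N) * (sqrt (INR N) * (1 + t))) with (4 * (1 + t)) by (field; lra).
      replace (8 * sqrt (INR N) / (1 + t) * (sqrt (INR N) * (1 + t)))
        with (8 * (sqrt (INR N) * sqrt (INR N))) by (field; lra).
      rewrite sqrt_sqrt by lra. lra. }
  assert (P : 0 < sqrt (INR N) / (1 + t)) by (apply Rdiv_lt_0_compat; lra).
  unfold Rdiv in *. nra.
Qed.

(** * Mean square of the Dirichlet polynomial with weight [X - t] *)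

Lemma is_RInt_Rext (f g : R -> R) (a b v : R) : (forall t, f t = g t) ->
  is_RInt f a b v -> is_RInt g a b v.
Proof. intros H. apply is_RInt_ext. intros t _. apply H. Qed.

Lemma is_RInt_Rplus (f g : R -> R) (a b u v : R) : is_RInt f a b u -> is_RInt g a b v ->
  is_RInt (fun t => f t + g t) a b (u + v).
Proof. exact (@is_RInt_plus R_NormedModule f g a b u v). Qed.

Lemma is_RInt_Rscal (f : R -> R) (a b c u : R) : is_RInt f a b u ->
  is_RInt (fun t => c * f t) a b (c * u).
Proof. exact (@is_RInt_scal R_NormedModule f a b c u). Qed.

Lemma is_RInt_fejer_cos (X l : R) : l <> 0 ->
  is_RInt (fun t => (X - t) * cos (l * t)) 0 X ((1 - cos (l * X)) / l ^ 2).
Proof.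
  intros Hl.
  replace ((1 - cos (l * X)) / l ^ 2) with
   (minus ((X - X) * (sin (l * X) / l) - cos (l * X) / l ^ 2)
          ((X - 0) * (sin (l * 0) / l) - cos (l * 0) / l ^ 2)).
  2:{ unfold minus, plus, opp; cbn -[pow]. rewrite Rmult_0_r, sin_0, cos_0. field. auto. }
  apply (is_RInt_derive (fun t => (X - t) * (sin (l * t) / l) - cos (l * t) / l ^ 2)).
  - intros t _. auto_derive; [exact I|]. field. auto.
  - intros t _. apply continuity_pt_filterlim. reg.
Qed.

Lemma is_RInt_fejer_const (X c : R) :
  is_RInt (fun t => (X - t) * c) 0 X (X ^ 2 / 2 * c).
Proof.
  replace (X ^ 2 / 2 * c) with
   (minus ((X * X - X ^ 2 / 2) * c) ((X * 0 - 0 ^ 2 / 2) * c)).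
  2:{ unfold minus, plus, opp; cbn -[pow]. field. }
  apply (is_RInt_derive (fun t => (X * t - t ^ 2 / 2) * c)).
  - intros t _. auto_derive; [exact I|]. field.
  - intros t _. apply continuity_pt_filterlim. reg.
Qed.

Lemma dir_cross (t : R) (m n : nat) :
  fst (dir t m) * fst (dir t n) + snd (dir t m) * snd (dir t n)
  = / sqrt (INR m) * / sqrt (INR n) * cos ((ln (INR n) - ln (INR m)) * t).
Proof.
  unfold dir, cis, Cmult, RtoC; cbn [fst snd].
  rewrite !cos_neg, !sin_neg.
  replace ((ln (INR n) - ln (INR m)) * t) with (t * ln (INR n) - t * ln (INR m)) by ring.
  rewrite cos_minus. ring.
Qed.

Lemma ln_minus_lb (x y : R) : 0 < x -> x <= y -> (y - x) / y <= ln y - ln x.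
Proof.
  intros Hx Hy. generalize (exp_ineq1_le (ln x - ln y)).
  rewrite <- ln_div, exp_ln by (try apply Rdiv_lt_0_compat; lra).
  rewrite ln_div by lra. replace ((y - x) / y) with (1 - x / y) by (field; lra). lra.
Qed.

(** Because [h + 1 <= 2 h]. The telescoping form lets the sums of inverse squares be carried through
    an induction in closed form. *)
Lemma inv_sq_telescope (h : R) : 1 <= h -> / h ^ 2 <= 2 * (/ h - / (h + 1)).
Proof.
  intros Hh. apply (Rmult_le_reg_l (h ^ 2 * (h + 1))); [nra|].
  replace (h ^ 2 * (h + 1) * / h ^ 2) with (h + 1) by (field; lra).
  replace (h ^ 2 * (h + 1) * (2 * (/ h - / (h + 1)))) with (2 * h) by (field; lra).
  lra.
Qed.

(** The right side separates small [x] from [x] close to [y]; either part is summable over integers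
    [x < y]. With [h = y - x], the estimates [ln y - ln x >= h / y] and [1 / sqrt (x y) <= 1 / x]
    reduce it to [2 x (x + h) <= h^2 + 3 x^2], that is [0 <= (h - x)^2]. *)
Lemma fejer_offdiag_term (x y : R) : 1 <= x -> x + 1 <= y ->
  / sqrt x * / sqrt y * (2 / (ln y - ln x) ^ 2) <= y * (/ x ^ 2 + 3 * / (y - x) ^ 2).
Proof.
  intros Hx Hy.
  assert (L := ln_minus_lb x y ltac:(lra) ltac:(lra)).
  assert (L0 : 0 < (y - x) / y) by (apply Rdiv_lt_0_compat; lra).
  assert (K : 2 / (ln y - ln x) ^ 2 <= 2 * (y / (y - x)) ^ 2).
  { unfold Rdiv at 1. apply Rmult_le_compat_l; [lra|].
    replace ((y / (y - x)) ^ 2) with (/ ((y - x) / y) ^ 2) by (field; lra).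
    apply Rinv_le_contravar; [apply pow_lt; lra|]. apply pow_incr; lra. }
  assert (Q : / sqrt x * / sqrt y <= / x).
  { assert (0 < sqrt x) by (apply sqrt_lt_R0; lra).
    assert (sqrt x <= sqrt y) by (apply sqrt_le_1_alt; lra).
    rewrite <- Rinv_mult. apply Rinv_le_contravar; [lra|].
    rewrite <- (sqrt_sqrt x) at 1 by lra. nra. }
  assert (Q0 : 0 < / sqrt x * / sqrt y)
    by (apply Rmult_lt_0_compat; apply Rinv_0_lt_compat, sqrt_lt_R0; lra).
  apply Rle_trans with (/ x * (2 * (y / (y - x)) ^ 2)).
  - apply Rmult_le_compat; try lra.
    apply Rmult_le_pos; [lra|]. apply Rlt_le, Rinv_0_lt_compat, pow_lt. lra.
  - set (h := y - x) in *. assert (1 <= h) by (unfold h; lra).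
    replace y with (x + h) by (unfold h; ring).
    apply (Rmult_le_reg_l (x ^ 2 * h ^ 2)); [apply Rmult_lt_0_compat; apply pow_lt; lra|].
    replace (x ^ 2 * h ^ 2 * (/ x * (2 * ((x + h) / h) ^ 2))) with (2 * x * (x + h) ^ 2) by (field; lra).
    replace (x ^ 2 * h ^ 2 * ((x + h) * (/ x ^ 2 + 3 * / h ^ 2)))
      with ((x + h) * (h ^ 2 + 3 * x ^ 2)) by (field; lra).
    assert (0 <= (x + h) * (h - x) ^ 2) by (apply Rmult_le_pos; [lra|apply pow2_ge_0]).
    nra.
Qed.

(** The two brackets are the telescoped sums of [1 / x^2] and [3 / (n - x)^2] over [x <= N]; for
    [N = n - 1] the bound is at most [8 n]. The lower bound 0 rests on [1 - cos >= 0]. *)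
Lemma fejer_cross_bound (X : R) (n N : nat) : (N < n)%nat ->
  exists v, is_RInt (fun t => (X - t) *
     (fst (dir_sum t N) * fst (dir t n) + snd (dir_sum t N) * snd (dir t n))) 0 X v /\
   0 <= v <= INR n * (2 * (1 - / (INR N + 1)) + 6 * (/ (INR n - INR N) - / INR n)).
Proof.
  induction N as [|N IH]; intros HN.
  - exists 0. split.
    + apply (is_RInt_Rext (fun t => (X - t) * 0)).
      { intros t. unfold dir_sum; cbn. ring. }
      assert (Z := is_RInt_fejer_const X 0). rewrite (Rmult_0_r (X ^ 2 / 2)) in Z. exact Z.
    + cbn [INR]. rewrite Rplus_0_l, Rinv_1, Rminus_0_r. lra.
  - destruct (IH ltac:(lia)) as [v [Hv Bv]].
    assert (Hn : INR (S N) + 1 <= INR n) by (rewrite <- S_INR; apply le_INR; lia).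
    assert (HN0 := pos_INR N). rewrite S_INR in Hn.
    set (l := ln (INR n) - ln (INR (S N))).
    assert (Hl : 0 < l).
    { unfold l. rewrite S_INR.
      eapply Rlt_le_trans; [|apply ln_minus_lb; lra]. apply Rdiv_lt_0_compat; lra. }
    exists (v + / sqrt (INR (S N)) * / sqrt (INR n) * ((1 - cos (l * X)) / l ^ 2)).
    split.
    + apply (is_RInt_Rext (fun t =>
        (X - t) * (fst (dir_sum t N) * fst (dir t n) + snd (dir_sum t N) * snd (dir t n)) +
        / sqrt (INR (S N)) * / sqrt (INR n) * ((X - t) * cos (l * t)))).
      { intros t. unfold l.
        assert (D := dir_cross t (S N) n).
        transitivity ((X - t) * (fst (dir_sum t N) * fst (dir t n) + snd (dir_sum t N) * snd (dir t n)) +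
          (X - t) * (fst (dir t (S N)) * fst (dir t n) + snd (dir t (S N)) * snd (dir t n))).
        - rewrite D. ring.
        - unfold dir_sum; cbn [csum Cplus fst snd]. ring. }
      apply is_RInt_Rplus; [exact Hv|].
      apply is_RInt_Rscal, is_RInt_fejer_cos. lra.
    + assert (T := fejer_offdiag_term (INR (S N)) (INR n)). fold l in T.
      rewrite !S_INR in *.
      specialize (T ltac:(lra) ltac:(lra)).
      assert (U1 := inv_sq_telescope (INR N + 1) ltac:(lra)).
      assert (U2 := inv_sq_telescope (INR n - (INR N + 1)) ltac:(lra)).
      replace (INR n - (INR N + 1) + 1) with (INR n - INR N) in U2 by ring.
      assert (P : 0 < / sqrt (INR N + 1) * / sqrt (INR n))
        by (apply Rmult_lt_0_compat; apply Rinv_0_lt_compat, sqrt_lt_R0; lra).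
      assert (Hl2 : 0 < / l ^ 2) by (apply Rinv_0_lt_compat, pow_lt; lra).
      assert (F : 0 <= (1 - cos (l * X)) / l ^ 2 <= 2 / l ^ 2).
      { generalize (COS_bound (l * X)); unfold Rdiv; nra. }
      set (f := (1 - cos (l * X)) / l ^ 2) in *.
      split; [nra|].
      apply Rle_trans with (v + INR n * (/ (INR N + 1) ^ 2 + 3 * / (INR n - (INR N + 1)) ^ 2)).
      * apply Rplus_le_compat_l. eapply Rle_trans; [|exact T]. apply Rmult_le_compat_l; lra.
      * apply Rle_trans with (INR n * (2 * (1 - / (INR N + 1)) + 6 * (/ (INR n - INR N) - / INR n)) +
          INR n * (/ (INR N + 1) ^ 2 + 3 * / (INR n - (INR N + 1)) ^ 2)); [lra|].
        rewrite <- Rmult_plus_distr_l. apply Rmult_le_compat_l; lra.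
Qed.

Fixpoint harmonic (n : nat) : R :=
  match n with O => 0 | S m => harmonic m + / INR (S m) end.

Lemma harmonic_bounds (N : nat) : (1 <= N)%nat -> ln (INR N) <= harmonic N <= 1 + ln (INR N).
Proof.
  intros HN. destruct N as [|N]; [lia|]. clear HN.
  (* The shift by 1 makes the induction close: the step [ln (n + 1) - ln n] is at most [1 / n], but
     not at most [1 / (n + 1)]. *)
  assert (L : ln (INR (S N) + 1) <= harmonic (S N)).
  { induction N as [|N IH].
    - cbn [harmonic INR]. generalize (ln_minus_bounds 1 ltac:(lra)). rewrite ln_1; lra.
    - change (harmonic (S (S N))) with (harmonic (S N) + / INR (S (S N))).
      generalize (ln_minus_bounds _ (INR_S_pos (S N))). rewrite (S_INR (S N)) in *. lra. }
  split.
  - apply Rle_trans with (2 := L). apply ln_le; generalize (INR_S_pos N); lra.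
  - clear L. induction N as [|N IH].
    + cbn [harmonic INR]. rewrite ln_1; lra.
    + change (harmonic (S (S N))) with (harmonic (S N) + / INR (S (S N))).
      generalize (ln_minus_bounds _ (INR_S_pos N)). rewrite (S_INR (S N)). lra.
Qed.

(** Each new term adds its own square [1 / (N + 1)], which builds up [harmonic], and twice a cross
    term, at most [16 (N + 1) <= 16 ((N + 1)^2 - N^2)]. *)
Lemma dir_sum_fejer (X : R) (N : nat) :
  exists v, is_RInt (fun t => (X - t) * Cmod (dir_sum t N) ^ 2) 0 X v /\
   X ^ 2 / 2 * harmonic N <= v <= X ^ 2 / 2 * harmonic N + 16 * INR N ^ 2.
Proof.
  induction N as [|N [v [Hv Bv]]].
  - exists 0. split.
    + apply (is_RInt_Rext (fun t => (X - t) * 0)).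
      { intros t. unfold dir_sum; cbn [csum]. rewrite Cmod_0. ring. }
      assert (Z := is_RInt_fejer_const X 0). rewrite (Rmult_0_r (X ^ 2 / 2)) in Z. exact Z.
    + cbn [harmonic INR]. lra.
  - destruct (fejer_cross_bound X (S N) N ltac:(lia)) as [w [Hw Bw]].
    exists (v + X ^ 2 / 2 * / INR (S N) + 2 * w). split.
    + apply (is_RInt_Rext (fun t =>
        (X - t) * Cmod (dir_sum t N) ^ 2 + (X - t) * / INR (S N) +
        2 * ((X - t) * (fst (dir_sum t N) * fst (dir t (S N)) + snd (dir_sum t N) * snd (dir t (S N)))))).
      { intros t.
        assert (E : / INR (S N) = fst (dir t (S N)) ^ 2 + snd (dir t (S N)) ^ 2).
        { rewrite <- Cmod_sq, Cmod_dir, pow_inv, pow2_sqrt by (try lia; apply pos_INR). reflexivity. }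
        rewrite E, !Cmod_sq.
        change (dir_sum t (S N)) with (dir_sum t N + dir t (S N))%C.
        unfold Cplus; cbn [fst snd]. ring. }
      apply is_RInt_Rplus.
      * apply is_RInt_Rplus; [exact Hv|apply is_RInt_fejer_const].
      * apply is_RInt_Rscal, Hw.
    + cbn [harmonic]. rewrite S_INR in *. assert (HN0 := pos_INR N).
      replace (INR N + 1 - INR N) with 1 in Bw by ring. rewrite Rinv_1 in Bw.
      assert (0 < / (INR N + 1)) by (apply Rinv_0_lt_compat; lra).
      assert (w <= (INR N + 1) * 8).
      { eapply Rle_trans; [apply Bw|]. apply Rmult_le_compat_l; lra. }
      nra.
Qed.

(** * Mean square of zeta with weight [X - t] *)

Lemma nat_just_above (t : R) : 0 <= t -> exists N, (1 <= N)%nat /\ t <= INR N <= t + 1.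
Proof.
  intros Ht. destruct (nfloor_ex t Ht) as [n Hn].
  exists (S n). rewrite S_INR. split; [lia|lra].
Qed.

Lemma sqrt_le_self (x : R) : 1 <= x -> sqrt x <= x.
Proof.
  intros Hx. rewrite <- (sqrt_pow2 x) at 2 by lra. apply sqrt_le_1_alt. nra.
Qed.

(** Each of the at most [t + 1] terms of the polynomial has modulus at most 1, whence
    [2529 = 2528 + 1]. This serves where any polynomial bound will do: small [t], and the endpoint
    [mu y]. *)
Lemma Zsq_le_pow2 (t : R) : 0 <= t -> Zsq t <= 2529 ^ 2 * (1 + t) ^ 2.
Proof.
  intros Ht. destruct (nat_just_above t Ht) as [N [HN Bt]].
  assert (A := zeta_approx t N HN ltac:(lra)).
  assert (HN1 : 1 <= INR N) by (apply (le_INR 1); lia).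
  assert (B : Cmod (dir_sum t N) <= INR N * 1).
  { apply csum_triangle. intros k _. rewrite Cmod_dir by lia.
    rewrite <- Rinv_1. apply Rinv_le_contravar; [lra|].
    rewrite <- sqrt_1. apply sqrt_le_1_alt, (le_INR 1). lia. }
  assert (D : 2528 * sqrt (INR N) / (1 + t) <= 2528 * (1 + t)).
  { apply Rle_trans with (2528 * sqrt (INR N)).
    - apply (Rmult_le_reg_r (1 + t)); [lra|].
      unfold Rdiv. rewrite Rmult_assoc, Rinv_l by lra.
      generalize (sqrt_pos (INR N)); nra.
    - generalize (sqrt_le_self (INR N)); lra. }
  rewrite Zsq_zeta, <- Rpow_mult_distr. apply pow_incr. split; [apply Cmod_ge_0|].
  replace (zeta t) with ((zeta t - dir_sum t N) + dir_sum t N)%C by ring.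
  eapply Rle_trans; [apply Cmod_triangle|]. lra.
Qed.

(** The primitive [atan (t / a)] stays below [PI / 2], so the mass is bounded independently of the
    width [a], which will be 1 and [ln X]. *)
Lemma atan_kernel (a X : R) : 0 < a -> exists v,
  is_RInt (fun t => a / (a ^ 2 + t ^ 2)) 0 X v /\ v <= 2.
Proof.
  intros Ha. exists (atan (X / a)). split.
  - replace (atan (X / a)) with (minus (atan (X / a)) (atan (0 / a))).
    2:{ unfold Rdiv at 2. rewrite Rmult_0_l, atan_0. unfold minus, plus, opp; cbn. ring. }
    apply (is_RInt_derive (fun t => atan (t / a))).
    + intros t _. apply is_derive_Reals.
      replace (a / (a ^ 2 + t ^ 2)) with (/ (1 + (t / a) ^ 2) * / a).
      2:{ field. generalize (pow2_ge_0 t); split; nra. }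
      apply (derivable_pt_lim_comp (fun t => t / a) atan).
      * apply is_derive_Reals. auto_derive; [exact I|]. field. lra.
      * apply derivable_pt_lim_atan.
    + intros t _. apply continuity_pt_filterlim. reg. generalize (pow2_ge_0 t); nra.
  - generalize (atan_bound (X / a)) PI_4. lra.
Qed.

(** Fourth power of [u / 4 <= exp (u / 4)]; hence [256 = 4^4]. *)
Lemma pow4_le_exp (u : R) : 0 <= u -> u ^ 4 <= 256 * exp u.
Proof.
  intros Hu. replace u with (u / 4 + u / 4 + u / 4 + u / 4) at 2 by field.
  rewrite !exp_plus. generalize (exp_ineq1_le (u / 4)). set (e := exp (u / 4)). intros He.
  replace (u ^ 4) with (256 * (u / 4) ^ 4) by field.
  apply Rmult_le_compat_l; [lra|].
  replace (e * e * e * e) with (e ^ 4) by ring. apply pow_incr. lra.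
Qed.

Lemma one_le_ln3 (X : R) : 3 <= X -> 1 <= ln X.
Proof.
  intros HX. rewrite <- (ln_exp 1). apply ln_le; [apply exp_pos|].
  generalize exp_le_3; lra.
Qed.

Lemma one_plus_ln_pow4 (X : R) : 3 <= X -> (1 + ln X) ^ 4 <= 768 * X.
Proof.
  intros HX. generalize (one_le_ln3 X HX). intros HL.
  eapply Rle_trans; [apply pow4_le_exp; lra|].
  rewrite exp_plus, exp_ln by lra. generalize exp_le_3; nra.
Qed.

(** Two kernels of bounded mass with coefficients [O(X)] when [N] is close to [X]: the first covers
    [t < ln X], the second [t >= ln X]. The integral over [[0, X]] is thus [O(X)], and [O(X^2)]
    after the weight [X - t <= X]. *)
Definition fejer_error (X : R) (N : nat) (t : R) : R :=
  (4 * 2528 ^ 2 * INR N + 2529 ^ 2 * (1 + ln X) ^ 4) * (1 / (1 ^ 2 + t ^ 2))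
  + 4 * 2528 ^ 2 * INR N * (ln X / (ln X ^ 2 + t ^ 2)).

(* The error of [zeta_approx] is only small for [t >= ln X]; below that the trivial bound
   for [Zsq] already integrates to a power of [ln X]. *)
Lemma Zsq_dir_sum_close (X t : R) (N : nat) : 3 <= X -> (1 <= N)%nat -> X <= INR N ->
  0 <= t <= X ->
  Rabs (Zsq t - Cmod (dir_sum t N) ^ 2) <= / ln X * Cmod (dir_sum t N) ^ 2 + fejer_error X N t.
Proof.
  intros HX HN HXN Ht. assert (HL := one_le_ln3 X HX).
  assert (HN1 : 1 <= INR N) by (apply (le_INR 1); lia).
  assert (A := zeta_approx t N HN ltac:(lra)).
  assert (Z := Zsq_le_pow2 t ltac:(lra)).
  rewrite Zsq_zeta in *. unfold fejer_error.
  set (L := ln X) in *. set (s := Cmod (dir_sum t N)). set (z := Cmod (zeta t)) in *.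
  set (e := Cmod (zeta t - dir_sum t N)) in *.
  assert (Hs : 0 <= s) by apply Cmod_ge_0. assert (Hz : 0 <= z) by apply Cmod_ge_0.
  assert (He : 0 <= e) by apply Cmod_ge_0.
  assert (T1 : z <= s + e).
  { unfold z, s, e. replace (zeta t) with (dir_sum t N + (zeta t - dir_sum t N))%C at 1 by ring.
    apply Cmod_triangle. }
  assert (T2 : s <= z + e).
  { unfold z, s, e. rewrite <- (Cmod_opp (zeta t - _)).
    replace (dir_sum t N) with (zeta t + - (zeta t - dir_sum t N))%C at 1 by ring.
    apply Cmod_triangle. }
  assert (E2 : e ^ 2 <= 2528 ^ 2 * INR N * / (1 + t) ^ 2).
  { replace (2528 ^ 2 * INR N * / (1 + t) ^ 2) with ((2528 * sqrt (INR N) / (1 + t)) ^ 2).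
    - apply pow_incr; lra.
    - unfold Rdiv. rewrite !Rpow_mult_distr, pow_inv, pow2_sqrt by lra. ring. }
  assert (W : Rabs (z ^ 2 - s ^ 2) <= e * (2 * s + e)) by (apply Rabs_le; nra).
  set (F := 2528 ^ 2 * INR N) in *.
  assert (HF : 0 <= F) by (unfold F; nra).
  assert (HiL : 0 < / L) by (apply Rinv_0_lt_compat; lra).
  assert (HLi : L * / L = 1) by (apply Rinv_r; lra).
  assert (P1 : 0 < / (1 + t ^ 2)) by (apply Rinv_0_lt_compat; nra).
  assert (P2 : 0 < / (L ^ 2 + t ^ 2)) by (apply Rinv_0_lt_compat; nra).
  assert (P3 : 0 < / (1 + t) ^ 2) by (apply Rinv_0_lt_compat, pow_lt; lra).
  replace (1 / (1 ^ 2 + t ^ 2)) with (/ (1 + t ^ 2)) by (field; nra).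
  replace (4 * 2528 ^ 2 * INR N) with (4 * F) by (unfold F; ring).
  unfold Rdiv.
  eapply Rle_trans; [exact W|].
  assert (Hs2 : 0 <= / L * s ^ 2) by (apply Rmult_le_pos; [lra|apply pow2_ge_0]).
  assert (Hl4 : 0 <= 2529 ^ 2 * (1 + L) ^ 4) by (apply Rmult_le_pos; [lra|apply pow_le; lra]).
  assert (HFL : 0 <= 4 * F * (L * / (L ^ 2 + t ^ 2))) by (repeat apply Rmult_le_pos; lra).
  destruct (Rle_lt_dec L t) as [H|H].
  (* Weighted inequality [2 s e <= s^2 / L + L e^2]. The mean of [s^2] has size [X^2 L], so the
     first part costs [O(X^2)]; the factor [L] in the second is absorbed by the kernel of width
     [L]. *)
  - assert (Q : e * (2 * s + e) <= / L * s ^ 2 + 2 * L * e ^ 2).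
    { assert (0 <= / L * (s - L * e) ^ 2) by (apply Rmult_le_pos; [lra|apply pow2_ge_0]).
      replace (/ L * (s - L * e) ^ 2) with
        (/ L * s ^ 2 - 2 * (L * / L) * (s * e) + (L * / L) * L * e ^ 2) in H0 by ring.
      rewrite HLi in H0. nra. }
    assert (Q2 : / (1 + t) ^ 2 <= 2 * / (L ^ 2 + t ^ 2)).
    { replace (2 * / (L ^ 2 + t ^ 2)) with (/ ((L ^ 2 + t ^ 2) / 2)) by (field; nra).
      apply Rinv_le_contravar; nra. }
    assert (Q3 : 2 * L * e ^ 2 <= 4 * F * (L * / (L ^ 2 + t ^ 2))).
    { replace (4 * F * (L * / (L ^ 2 + t ^ 2))) with (2 * L * (F * (2 * / (L ^ 2 + t ^ 2)))) by ring.
      apply Rmult_le_compat_l; [lra|]. eapply Rle_trans; [exact E2|].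
      apply Rmult_le_compat_l; lra. }
    assert (0 <= (4 * F + 2529 ^ 2 * (1 + L) ^ 4) * / (1 + t ^ 2)) by (apply Rmult_le_pos; lra).
    lra.
  (* Here [s <= z + e] trades [s] for [z], which has a bound independent of [N]. *)
  - assert (Q : e * (2 * s + e) <= z ^ 2 + 4 * e ^ 2).
    { generalize (pow2_ge_0 (z - e)). nra. }
    assert (Q1 : e ^ 2 <= F * / (1 + t ^ 2)).
    { eapply Rle_trans; [exact E2|]. apply Rmult_le_compat_l; [lra|].
      apply Rinv_le_contravar; nra. }
    assert (Q2 : z ^ 2 <= 2529 ^ 2 * (1 + L) ^ 4 * / (1 + t ^ 2)).
    { eapply Rle_trans; [exact Z|]. rewrite Rmult_assoc. apply Rmult_le_compat_l; [lra|].
      apply (Rmult_le_reg_r (1 + t ^ 2)); [nra|].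
      rewrite (Rmult_assoc _ (/ _)), Rinv_l, Rmult_1_r by nra.
      replace ((1 + L) ^ 4) with ((1 + L) ^ 2 * (1 + L) ^ 2) by ring.
      apply Rmult_le_compat; [apply pow2_ge_0|nra|apply pow_incr; lra|].
      assert (t ^ 2 <= L ^ 2) by (apply pow_incr; lra). nra. }
    lra.
Qed.

Lemma continuity_pt_continuous (f : R -> R) (x : R) : continuity_pt f x -> continuous f x.
Proof. apply continuity_pt_filterlim. Qed.

Definition Zsq_fejer (X : R) : R := RInt (fun t => (X - t) * Zsq t) 0 X.

Lemma Zsq_fejer_correct (X : R) : is_RInt (fun t => (X - t) * Zsq t) 0 X (Zsq_fejer X).
Proof.
  apply (RInt_correct (V := R_CompleteNormedModule)).
  apply (ex_RInt_continuous (V := R_CompleteNormedModule)). intros t _.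
  apply continuity_pt_continuous.
  apply (continuity_pt_mult (fun t => X - t) Zsq); [reg|apply Zsq_continuity].
Qed.

Lemma Zsq_fejer_asymp : exists C, 0 < C /\ forall X, 3 <= X ->
  Rabs (Zsq_fejer X - X ^ 2 / 2 * ln X) <= C * X ^ 2.
Proof.
  exists (10 ^ 12). split; [lra|]. intros X HX.
  assert (HX0 : 0 <= X) by lra.
  destruct (nat_just_above X ltac:(lra)) as [N [HN BN]].
  destruct (dir_sum_fejer X N) as [I [HI BI]].
  assert (HL := one_le_ln3 X HX). assert (HL4 := one_plus_ln_pow4 X HX).
  destruct (harmonic_bounds N HN) as [BH1 BH2].
  assert (LN1 : ln X <= ln (INR N)) by (apply ln_le; lra).
  assert (LN2 : ln (INR N) <= ln X + 1).
  { apply Rle_trans with (ln (X + 1)); [apply ln_le; lra|].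
    generalize (ln_minus_bounds X ltac:(lra)).
    assert (/ X <= 1) by (rewrite <- Rinv_1; apply Rinv_le_contravar; lra). lra. }
  destruct (atan_kernel 1 X ltac:(lra)) as [v1 [Hv1 B1]].
  destruct (atan_kernel (ln X) X ltac:(lra)) as [v2 [Hv2 B2]].
  set (a := 4 * 2528 ^ 2 * INR N + 2529 ^ 2 * (1 + ln X) ^ 4) in *.
  set (b := 4 * 2528 ^ 2 * INR N) in *.
  assert (HG : is_RInt (fejer_error X N) 0 X (a * v1 + b * v2)).
  { apply is_RInt_Rplus; apply is_RInt_Rscal; assumption. }
  assert (Ha : 0 <= a <= 10 ^ 11 * X).
  { unfold a, b. assert (0 <= (1 + ln X) ^ 4) by (apply pow_le; lra). lra. }
  assert (Hb : 0 <= b <= 10 ^ 10 * X) by (unfold b; lra).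
  set (g := a * v1 + b * v2) in *.
  assert (Hg : g <= 3 * 10 ^ 11 * X) by (unfold g; nra).
  assert (HXsq : 0 < X ^ 2) by nra.
  assert (BI1 : X ^ 2 / 2 * ln X <= I).
  { eapply Rle_trans; [|apply BI]. apply Rmult_le_compat_l; lra. }
  assert (BI2 : I <= X ^ 2 / 2 * ln X + 65 * X ^ 2).
  { eapply Rle_trans; [apply BI|].
    assert (X ^ 2 / 2 * harmonic N <= X ^ 2 / 2 * (ln X + 2)) by (apply Rmult_le_compat_l; lra).
    assert (INR N ^ 2 <= (2 * X) ^ 2) by (apply pow_incr; lra). nra. }
  assert (BIL : / ln X * I <= 66 * X ^ 2).
  { apply (Rmult_le_reg_l (ln X)); [lra|]. rewrite <- Rmult_assoc, Rinv_r by lra. nra. }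
  assert (HU : is_RInt (fun t => / ln X * ((X - t) * Cmod (dir_sum t N) ^ 2) + X * fejer_error X N t)
     0 X (/ ln X * I + X * g)).
  { apply is_RInt_Rplus; apply is_RInt_Rscal; assumption. }
  assert (D : forall t, 0 < t < X ->
     Rabs ((X - t) * Zsq t - (X - t) * Cmod (dir_sum t N) ^ 2) <=
     / ln X * ((X - t) * Cmod (dir_sum t N) ^ 2) + X * fejer_error X N t).
  { intros t Ht. rewrite <- Rmult_minus_distr_l, Rabs_mult, Rabs_pos_eq by lra.
    assert (Q := Zsq_dir_sum_close X t N HX HN ltac:(lra) ltac:(lra)).
    apply Rle_trans with ((X - t) * (/ ln X * Cmod (dir_sum t N) ^ 2 + fejer_error X N t)).
    - apply Rmult_le_compat_l; lra.
    - rewrite Rmult_plus_distr_l. apply Rplus_le_compat; [right; ring|].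
      apply Rmult_le_compat_r; [|lra].
      unfold fejer_error. fold b. fold a. apply Rplus_le_le_0_compat; apply Rmult_le_pos; try lra;
      apply Rmult_le_pos; try lra; apply Rlt_le, Rinv_0_lt_compat; nra. }
  (* The pointwise bound is integrated once in each direction, so that no integral of an absolute
     value occurs. *)
  assert (U1 := is_RInt_le _ _ _ _ _ _ HX0 (Zsq_fejer_correct X) (is_RInt_Rplus _ _ _ _ _ _ HI HU)).
  assert (U2 := is_RInt_le _ _ _ _ _ _ HX0 HI (is_RInt_Rplus _ _ _ _ _ _ (Zsq_fejer_correct X) HU)).
  cbv beta in U1, U2.
  specialize (U1 ltac:(intros t Ht; specialize (D t Ht); apply Rabs_le_between in D; lra)).
  specialize (U2 ltac:(intros t Ht; specialize (D t Ht); apply Rabs_le_between in D; lra)).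
  assert (X * g <= X * (3 * 10 ^ 11 * X)) by (apply Rmult_le_compat_l; lra).
  apply Rabs_le. nra.
Qed.

(** * First and second primitive of [Z^2] *)

Lemma Rint_RInt (f : R -> R) (a b : R) : ex_RInt f a b -> Rint f a b = RInt f a b.
Proof.
  intros H. unfold Rint.
  assert (E : exists I, exists pr : Riemann_integrable f a b, RiemannInt pr = I).
  { exists (RiemannInt (ex_RInt_Reals_0 f a b H)). now exists (ex_RInt_Reals_0 f a b H). }
  destruct (epsilon_spec (inhabits 0) _ E) as [pr Hpr].
  etransitivity; [symmetry; exact Hpr|]. symmetry. apply RInt_Reals.
Qed.

Lemma ex_RInt_cont (f : R -> R) (a b : R) : (forall t, continuity_pt f t) -> ex_RInt f a b.
Proof.
  intros H. apply (ex_RInt_continuous (V := R_CompleteNormedModule)). intros t _.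
  apply continuity_pt_continuous, H.
Qed.

Lemma is_derive_RInt_cont (f : R -> R) (x : R) : (forall t, continuity_pt f t) ->
  is_derive (fun b => RInt f 0 b) x (f x).
Proof.
  intros H. apply (is_derive_RInt f (fun b => RInt f 0 b) 0).
  - apply filter_forall. intros b. apply (RInt_correct (V := R_CompleteNormedModule)).
    now apply ex_RInt_cont.
  - now apply continuity_pt_continuous.
Qed.

Definition Zsq_int (T : R) : R := RInt Zsq 0 T.

Lemma is_derive_Zsq_int (T : R) : is_derive Zsq_int T (Zsq T).
Proof. apply is_derive_RInt_cont, Zsq_continuity. Qed.

Lemma Zsq_int_correct (T : R) : is_RInt Zsq 0 T (Zsq_int T).
Proof.
  apply (RInt_correct (V := R_CompleteNormedModule)), ex_RInt_cont, Zsq_continuity.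
Qed.

Lemma is_derive_continuity_pt (f : R -> R) (x l : R) : is_derive f x l -> continuity_pt f x.
Proof.
  intros H. apply derivable_continuous_pt. exists l. now apply is_derive_Reals.
Qed.

Lemma nondecreasing_of_derive_nonneg (f df : R -> R) (a b : R) : a <= b ->
  (forall x, is_derive f x (df x)) -> (forall x, a <= x -> 0 <= df x) -> f a <= f b.
Proof.
  intros Hab Hd Hp. destruct (MVT_gen f a b df) as [c [Hc E]].
  - intros x _. apply Hd.
  - intros x _. eapply is_derive_continuity_pt, Hd.
  - rewrite Rmin_left, Rmax_right in Hc by lra.
    assert (0 <= df c * (b - a)) by (apply Rmult_le_pos; [apply Hp|]; lra). lra.
Qed.

Lemma Zsq_int_0 : Zsq_int 0 = 0.
Proof. unfold Zsq_int. now rewrite RInt_point. Qed.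

Lemma Zsq_int_incr (a b : R) : a <= b -> Zsq_int a <= Zsq_int b.
Proof.
  intros H. apply (nondecreasing_of_derive_nonneg _ Zsq); auto using is_derive_Zsq_int, Zsq_nonneg.
Qed.

Lemma Zsq_int_nonneg (a : R) : 0 <= a -> 0 <= Zsq_int a.
Proof. intros H. rewrite <- Zsq_int_0. now apply Zsq_int_incr. Qed.

Lemma Zsq_fejer_0 : Zsq_fejer 0 = 0.
Proof. unfold Zsq_fejer. now rewrite RInt_point. Qed.

(** Written as [X int Z^2 - int t Z^2], the two terms [X Z^2(X)] cancel. So [Zsq_fejer] is the
    second primitive of [Z^2]. *)
Lemma is_derive_Zsq_fejer (X : R) : is_derive Zsq_fejer X (Zsq_int X).
Proof.
  set (g := fun t => t * Zsq t).
  assert (Cg : forall t, continuity_pt g t).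
  { intros t. apply (continuity_pt_mult (fun t => t) Zsq); [reg|apply Zsq_continuity]. }
  apply (is_derive_ext (fun x => x * Zsq_int x + - RInt g 0 x)).
  - intros x. unfold Zsq_fejer. symmetry. apply (is_RInt_unique (V := R_CompleteNormedModule)).
    apply (is_RInt_Rext (fun t => x * Zsq t + (-1) * g t)); [intros t; unfold g; ring|].
    replace (- RInt g 0 x) with ((-1) * RInt g 0 x) by ring.
    apply is_RInt_Rplus; apply is_RInt_Rscal; [apply Zsq_int_correct|].
    apply (RInt_correct (V := R_CompleteNormedModule)), ex_RInt_cont, Cg.
  - assert (D1 := is_derive_Zsq_int X). assert (D2 := is_derive_RInt_cont g X Cg).
    apply is_derive_Reals in D1, D2. apply is_derive_Reals.
    replace (Zsq_int X) with ((1 * Zsq_int X + X * Zsq X) + - g X) by (unfold g; ring).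
    apply (derivable_pt_lim_plus (fun x => x * Zsq_int x) (fun x => - RInt g 0 x)).
    + apply (derivable_pt_lim_mult (fun x => x) Zsq_int); [apply derivable_pt_lim_id|exact D1].
    + apply (derivable_pt_lim_opp (fun x => RInt g 0 x)), D2.
Qed.

Lemma Zsq_fejer_le (x : R) : 0 <= x -> Zsq_fejer x <= x * Zsq_int x.
Proof.
  intros Hx. apply (is_RInt_le _ _ _ _ _ _ Hx (Zsq_fejer_correct x)
    (is_RInt_Rscal _ _ _ x _ (Zsq_int_correct x))).
  intros t Ht. apply Rmult_le_compat_r; [apply Zsq_nonneg|lra].
Qed.

Lemma Zsq_fejer_nonneg (x : R) : 0 <= x -> 0 <= Zsq_fejer x.
Proof.
  intros Hx. rewrite <- Zsq_fejer_0.
  apply (nondecreasing_of_derive_nonneg _ Zsq_int);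
    auto using is_derive_Zsq_fejer, Zsq_int_nonneg.
Qed.

Lemma Zsq_fejer_ge (x : R) : 0 <= x -> x * Zsq_int x <= Zsq_fejer (2 * x).
Proof.
  intros Hx. destruct (MVT_gen Zsq_fejer x (2 * x) Zsq_int) as [c [Hc E]].
  - intros y _. apply is_derive_Zsq_fejer.
  - intros y _. eapply is_derive_continuity_pt, is_derive_Zsq_fejer.
  - rewrite Rmin_left, Rmax_right in Hc by lra.
    assert (A := Zsq_int_incr x c ltac:(lra)). assert (B := Zsq_fejer_nonneg x Hx).
    assert (x * Zsq_int x <= x * Zsq_int c) by (apply Rmult_le_compat_l; lra). nra.
Qed.

(** Monotonicity alone passes from the second primitive to the first, through [Zsq_fejer x <= x *
    Zsq_int x <= Zsq_fejer (2 * x)]. The threshold gives [(ln x)/2 - C >= 1]. *)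
Lemma Zsq_int_bounds : exists C X0, 1 <= C /\ 3 <= X0 /\
  forall x, X0 <= x -> x <= Zsq_int x <= C * x * ln x.
Proof.
  destruct Zsq_fejer_asymp as [C [HC H]].
  exists (4 + 4 * C), (Rmax 3 (exp (2 * (C + 1)))).
  split; [lra|]. split; [apply Rmax_l|]. intros x Hx.
  assert (H3 := Rmax_l 3 (exp (2 * (C + 1)))). assert (He := Rmax_r 3 (exp (2 * (C + 1)))).
  assert (HL := one_le_ln3 x ltac:(lra)).
  assert (HLC : 2 * (C + 1) <= ln x).
  { rewrite <- (ln_exp (2 * (C + 1))). apply ln_le; [apply exp_pos|lra]. }
  split.
  - assert (A := H x ltac:(lra)). apply Rabs_le_between in A.
    assert (B := Zsq_fejer_le x ltac:(lra)).
    apply (Rmult_le_reg_l x); [lra|]. nra.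
  - assert (A := H (2 * x) ltac:(lra)). apply Rabs_le_between in A.
    assert (B := Zsq_fejer_ge x ltac:(lra)).
    rewrite ln_mult in A by lra.
    assert (L2 : ln 2 <= 1) by (generalize (exp_ineq1_le (ln 2)); rewrite exp_ln; lra).
    apply (Rmult_le_reg_l x); [lra|].
    assert (x ^ 2 <= x ^ 2 * ln x) by nra.
    assert (x ^ 2 * ln 2 <= x ^ 2) by nra.
    nra.
Qed.

(** * The first moment of [Z^2] under the exponential weight *)

Lemma ln_le_self (x : R) : 0 < x -> ln x <= x - 1.
Proof. intros Hx. generalize (exp_ineq1_le (ln x)). rewrite exp_ln by lra. lra. Qed.

(* Two integrations by parts applied to [w(t) Z^2(t)], [w(t) = t e^{-at}], leave [w''(t) Zsq_fejer(t)];
   the last summand is a primitive of the contribution [l w''(t) t^2/2] of the main term of [Zsq_fejer]. *)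
Definition laplace_primitive (a l t : R) : R :=
  t * exp (- a * t) * Zsq_int t - (1 - a * t) * exp (- a * t) * Zsq_fejer t
  - l * ((a * t ^ 3 / 2 + t ^ 2 / 2 + t / a + / a ^ 2) * exp (- a * t)).

Lemma is_derive_laplace_primitive (a l t : R) : 0 < a ->
  is_derive (laplace_primitive a l) t
   (t * (Zsq t * exp (- a * t)) - (a ^ 2 * t - 2 * a) * exp (- a * t) * (Zsq_fejer t - t ^ 2 / 2 * l)).
Proof.
  intros Ha. unfold laplace_primitive. auto_derive.
  - repeat split; try lra; eexists; [apply is_derive_Zsq_int|apply is_derive_Zsq_fejer].
  - replace (Derive (fun x : R => Zsq_int x) t) with (Zsq t)
      by (symmetry; apply is_derive_unique, is_derive_Zsq_int).
    replace (Derive (fun x : R => Zsq_fejer x) t) with (Zsq_int t)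
      by (symmetry; apply is_derive_unique, is_derive_Zsq_fejer).
    field. lra.
Qed.

(** Freezing [ln t] at [ln y] costs [(t^2 / 2) (u + 1 / u)] with [u = t / y], which is [y^2] times a
    polynomial in [u]. For [t < 3], outside the asymptotic range, [Zsq_fejer t <= 3 * Zsq_int 3]. *)
Lemma Zsq_fejer_scaled : exists C, 0 < C /\ forall y t, 3 <= y -> 0 < t ->
  Rabs (Zsq_fejer t - t ^ 2 / 2 * ln y) <= C * y ^ 2 * (1 + t / y) ^ 3.
Proof.
  destruct Zsq_fejer_asymp as [C [HC H]].
  assert (H3 := Zsq_int_nonneg 3 ltac:(lra)).
  exists (C + 3 * Zsq_int 3 + 6). split; [lra|]. intros y t Hy Ht.
  set (u := t / y). assert (Hu : 0 < u) by (apply Rdiv_lt_0_compat; lra).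
  assert (Et : t = u * y) by (unfold u; field; lra).
  set (c := 3 * Zsq_int 3) in *. assert (Hc : 0 <= c) by (unfold c; lra).
  assert (Hy2 : 9 <= y ^ 2) by nra.
  destruct (Rle_lt_dec 3 t) as [H1|H1].
  - assert (A := H t H1).
    assert (L : Rabs (ln t - ln y) <= u + / u).
    { rewrite <- ln_div by lra. fold u.
      assert (0 < / u) by (apply Rinv_0_lt_compat; lra).
      assert (B1 := ln_le_self u Hu). assert (B2 := ln_le_self (/ u) ltac:(lra)).
      rewrite ln_Rinv in B2 by lra. apply Rabs_le; lra. }
    replace (Zsq_fejer t - t ^ 2 / 2 * ln y) with
      ((Zsq_fejer t - t ^ 2 / 2 * ln t) + t ^ 2 / 2 * (ln t - ln y)) by ring.
    eapply Rle_trans; [apply Rabs_triang|].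
    rewrite Rabs_mult, (Rabs_pos_eq (t ^ 2 / 2)) by nra.
    assert (B : t ^ 2 / 2 * Rabs (ln t - ln y) <= t ^ 2 / 2 * (u + / u))
      by (apply Rmult_le_compat_l; [nra|exact L]).
    replace (t ^ 2 / 2 * (u + / u)) with (y ^ 2 * ((u ^ 3 + u) / 2)) in B by (rewrite Et; field; lra).
    replace (C * t ^ 2) with (y ^ 2 * (C * u ^ 2)) in A by (rewrite Et; ring).
    apply Rle_trans with (y ^ 2 * (C * u ^ 2 + (u ^ 3 + u) / 2)); [lra|].
    rewrite (Rmult_comm _ (y ^ 2)), Rmult_assoc. apply Rmult_le_compat_l; [lra|].
    assert (0 < u ^ 2) by nra. assert (0 < u ^ 3) by (apply pow_lt; lra).
    replace ((1 + u) ^ 3) with (1 + 3 * u + 3 * u ^ 2 + u ^ 3) by ring. nra.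
  - assert (F0 := Zsq_fejer_nonneg t ltac:(lra)). assert (F1 := Zsq_fejer_le t ltac:(lra)).
    assert (F2 := Zsq_int_incr t 3 ltac:(lra)).
    assert (F3 := Zsq_int_nonneg t ltac:(lra)).
    assert (F4 : Zsq_fejer t <= c) by (unfold c; nra).
    assert (L0 := one_le_ln3 y Hy). assert (L1 := ln_le_self y ltac:(lra)).
    assert (T2 : 0 <= t ^ 2 / 2 * ln y <= 5 * y).
    { assert (0 <= t ^ 2 <= 9) by nra. split; nra. }
    apply Rle_trans with ((C + c + 6) * y ^ 2 * 1).
    + rewrite Rmult_1_r. apply Rabs_le.
      assert (y <= y ^ 2) by nra. assert (0 <= C * y ^ 2) by nra. assert (c <= c * y ^ 2) by nra.
      lra.
    + apply Rmult_le_compat_l; [nra|].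
      rewrite <- (pow1 3). apply pow_incr; lra.
Qed.

(** In [u = t / y] the left side is [(4 / y) |u - 1| e^{-2u} (1 + u)^3]. One factor [e^{-u}] is
    spent on [(1 + u)^4 <= 768 e^u], the other is kept for integration; [3072 = 4 * 768]. *)
Lemma laplace_kernel_bound (y t : R) : 0 < y -> 0 < t ->
  Rabs ((2 / y) ^ 2 * t - 2 * (2 / y)) * exp (- (2 / y) * t) * (1 + t / y) ^ 3
  <= 3072 / y * exp (- / y * t).
Proof.
  intros Hy Ht. set (u := t / y).
  assert (Hu : 0 < u) by (apply Rdiv_lt_0_compat; lra).
  replace (- (2 / y) * t) with (- u + - u) by (unfold u; field; lra).
  replace (- / y * t) with (- u) by (unfold u; field; lra).
  assert (Hiy : 0 < / y) by (apply Rinv_0_lt_compat; lra).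
  assert (A : Rabs ((2 / y) ^ 2 * t - 2 * (2 / y)) <= 4 / y * (1 + u)).
  { replace ((2 / y) ^ 2 * t - 2 * (2 / y)) with (4 / y * (u - 1)) by (unfold u; field; lra).
    unfold Rdiv. rewrite Rabs_mult, (Rabs_pos_eq (4 * / y)) by lra.
    apply Rmult_le_compat_l; [lra|]. apply Rabs_le; lra. }
  assert (B := pow4_le_exp (1 + u) ltac:(lra)). rewrite exp_plus in B.
  assert (E := exp_le_3). assert (P := exp_pos u). assert (Q := exp_pos (- u)).
  assert (I : exp u * exp (- u) = 1) by (rewrite <- exp_plus, Rplus_opp_r; apply exp_0).
  assert (B' : (1 + u) ^ 4 <= 768 * exp u) by nra.
  rewrite exp_plus.
  assert (0 < (1 + u) ^ 3) by (apply pow_lt; lra).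
  assert (0 < exp (- u) * exp (- u)) by nra.
  apply Rle_trans with (4 / y * (1 + u) * (exp (- u) * exp (- u)) * (1 + u) ^ 3).
  - apply Rmult_le_compat_r; [lra|]. apply Rmult_le_compat_r; lra.
  - replace (4 / y * (1 + u) * (exp (- u) * exp (- u)) * (1 + u) ^ 3) with
      (4 / y * ((1 + u) ^ 4 * exp (- u) * exp (- u))) by ring.
    replace (3072 / y * exp (- u)) with (4 / y * (768 * (exp u * exp (- u)) * exp (- u)))
      by (rewrite I; field; lra).
    apply Rmult_le_compat_l; [unfold Rdiv; lra|].
    apply Rmult_le_compat_r; [lra|]. nra.
Qed.

Lemma mu_bounds (y : R) : 7 <= y -> y <= mu y <= y ^ 3.
Proof.
  intros Hy. unfold mu. generalize (one_le_ln3 y ltac:(lra)) (ln_le_self y ltac:(lra)). intros L1 L2.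
  split; [nra|]. replace (y ^ 3) with (y * y * y) by ring.
  apply Rmult_le_compat; nra.
Qed.

Lemma exp_mu (y : R) : 0 < y -> exp (- (2 / y) * mu y) = / y ^ 14.
Proof.
  intros Hy. unfold mu.
  replace (- (2 / y) * (7 * y * ln y)) with (- (INR 14 * ln y)) by (cbn [INR]; field; lra).
  rewrite exp_Ropp. f_equal. exact (Rpower_pow 14 y Hy).
Qed.

(** From [mu y <= y^3] every summand is, apart from the weight, at most a constant times [y^11], and
    the weight is [y^{-14}]. *)
Lemma laplace_primitive_end : exists C Y, 0 < C /\ 7 <= Y /\ forall y, Y <= y ->
  Rabs (laplace_primitive (2 / y) (ln y) (mu y)) <= C.
Proof.
  destruct Zsq_int_bounds as [C [X0 [HC [HX0 H]]]].
  exists (4 * C + 4), (Rmax 7 X0). split; [lra|]. split; [apply Rmax_l|]. intros y Hy.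
  assert (Hy7 := Rmax_l 7 X0). assert (HyX := Rmax_r 7 X0).
  assert (Hm := mu_bounds y ltac:(lra)). unfold laplace_primitive. rewrite exp_mu by lra.
  set (m := mu y) in *.
  assert (HM := H m ltac:(lra)). assert (Lm := ln_le_self m ltac:(lra)).
  assert (Ly := ln_le_self y ltac:(lra)). assert (Ly1 := one_le_ln3 y ltac:(lra)).
  assert (HF := Zsq_fejer_le m ltac:(lra)). assert (HF0 := Zsq_fejer_nonneg m ltac:(lra)).
  assert (HM2 : m * Zsq_int m <= C * y ^ 9).
  { apply Rle_trans with (m * (C * m * m)).
    - apply Rmult_le_compat_l; [lra|]. eapply Rle_trans; [apply HM|]. apply Rmult_le_compat_l; nra.
    - replace (m * (C * m * m)) with (C * m ^ 3) by ring.
      replace (y ^ 9) with ((y ^ 3) ^ 3) by ring.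
      apply Rmult_le_compat_l; [lra|]. apply pow_incr; lra. }
  assert (PW : forall k, (k <= 11)%nat -> y ^ k <= y ^ 11) by (intros; apply Rle_pow; [lra|lia]).
  assert (PP : forall k, 0 < y ^ k) by (intros; apply pow_lt; lra).
  assert (B1 : 0 <= m * Zsq_int m <= C * y ^ 11).
  { split; [nra|]. eapply Rle_trans; [exact HM2|]. apply Rmult_le_compat_l; [lra|]. apply PW; lia. }
  assert (B2 : Rabs ((1 - 2 / y * m) * Zsq_fejer m) <= 3 * C * y ^ 11).
  { rewrite Rabs_mult, (Rabs_pos_eq (Zsq_fejer m)) by lra.
    replace (3 * C * y ^ 11) with (3 * y ^ 2 * (C * y ^ 9)) by ring.
    apply Rmult_le_compat; [apply Rabs_pos|lra| |lra].
    assert (0 <= 2 / y * m <= 2 * y ^ 2).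
    { assert (0 < 2 / y) by (apply Rdiv_lt_0_compat; lra). split; [nra|].
      replace (2 * y ^ 2) with (2 / y * y ^ 3) by (field; lra). apply Rmult_le_compat_l; lra. }
    assert (1 <= y ^ 2) by nra. apply Rabs_le; lra. }
  assert (B3 : 0 <= ln y * (2 / y * m ^ 3 / 2 + m ^ 2 / 2 + m / (2 / y) + / (2 / y) ^ 2) <= 4 * y ^ 11).
  { replace (2 / y * m ^ 3 / 2 + m ^ 2 / 2 + m / (2 / y) + / (2 / y) ^ 2)
      with (/ y * m ^ 3 + m ^ 2 / 2 + m * y / 2 + y ^ 2 / 4) by (field; lra).
    assert (Hiy : 0 < / y) by (apply Rinv_0_lt_compat; lra).
    assert (M3 : 0 <= m ^ 3 <= y ^ 9).
    { split; [apply pow_le; lra|]. replace (y ^ 9) with ((y ^ 3) ^ 3) by ring. apply pow_incr; lra. }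
    assert (M2 : 0 <= m ^ 2 <= y ^ 6).
    { split; [apply pow_le; lra|]. replace (y ^ 6) with ((y ^ 3) ^ 2) by ring. apply pow_incr; lra. }
    assert (T1 : 0 <= / y * m ^ 3 <= y ^ 8).
    { split; [nra|]. replace (y ^ 8) with (/ y * y ^ 9) by (field; lra). apply Rmult_le_compat_l; lra. }
    assert (T3 : 0 <= m * y <= y ^ 4).
    { split; [nra|]. replace (y ^ 4) with (y ^ 3 * y) by ring. apply Rmult_le_compat_r; lra. }
    assert (W : forall k, (k <= 10)%nat -> y ^ k <= y ^ 10) by (intros; apply Rle_pow; [lra|lia]).
    assert (W8 := W 8%nat ltac:(lia)). assert (W6 := W 6%nat ltac:(lia)).
    assert (W4 := W 4%nat ltac:(lia)). assert (W2 := W 2%nat ltac:(lia)).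
    assert (P2 := PP 2%nat).
    split; [apply Rmult_le_pos; lra|].
    replace (4 * y ^ 11) with (y * (4 * y ^ 10)) by ring.
    apply Rmult_le_compat; lra. }
  match goal with |- Rabs ?x <= _ => replace x with
    ((m * Zsq_int m - (1 - 2 / y * m) * Zsq_fejer m -
      ln y * (2 / y * m ^ 3 / 2 + m ^ 2 / 2 + m / (2 / y) + / (2 / y) ^ 2)) * / y ^ 14) by ring end.
  assert (Hi : 0 < / y ^ 14) by (apply Rinv_0_lt_compat, PP).
  rewrite Rabs_mult, (Rabs_pos_eq (/ y ^ 14)) by lra.
  apply (Rmult_le_reg_r (y ^ 14)); [apply PP|].
  rewrite Rmult_assoc, Rinv_l, Rmult_1_r by (generalize (PP 14%nat); lra).
  apply Rle_trans with ((4 * C + 4) * y ^ 11).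
  - apply Rabs_le_between in B2. apply Rabs_le; lra.
  - apply Rmult_le_compat_l; [lra|]. apply Rle_pow; [lra|lia].
Qed.

Definition laplace_moment (y : R) : R :=
  RInt (fun t => t * (Zsq t * exp (- (2 / y) * t))) 0 (mu y).

Lemma continuity_pt_Zsq_exp (c t : R) : continuity_pt (fun t => Zsq t * exp (c * t)) t.
Proof.
  apply (continuity_pt_mult Zsq (fun t => exp (c * t))); [apply Zsq_continuity|reg].
Qed.

Lemma continuity_pt_t_Zsq_exp (c t : R) : continuity_pt (fun t => t * (Zsq t * exp (c * t))) t.
Proof.
  apply (continuity_pt_mult (fun t => t) (fun t => Zsq t * exp (c * t)));
    [reg|apply continuity_pt_Zsq_exp].
Qed.

Lemma laplace_moment_asymp : exists C Y, 0 < C /\ 7 <= Y /\ forall y, Y <= y ->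
  Rabs (laplace_moment y - y ^ 2 / 4 * ln y) <= C * y ^ 2.
Proof.
  destruct laplace_primitive_end as [C1 [Y [HC1 [HY H1]]]].
  destruct Zsq_fejer_scaled as [C2 [HC2 H2]].
  exists (C1 + C2 * 3072), Y. split; [lra|]. split; [lra|]. intros y Hy.
  assert (Hmu := mu_bounds y ltac:(lra)).
  assert (Hend := H1 y Hy).
  set (m := mu y) in *. set (a := 2 / y). assert (Ha : 0 < a) by (apply Rdiv_lt_0_compat; lra).
  set (l := ln y) in *. fold a in Hend.
  set (q := fun t => t * (Zsq t * exp (- a * t)) -
    (a ^ 2 * t - 2 * a) * exp (- a * t) * (Zsq_fejer t - t ^ 2 / 2 * l)).
  assert (Iq : is_RInt q 0 m (laplace_primitive a l m - laplace_primitive a l 0)).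
  { apply (is_RInt_derive (laplace_primitive a l) q).
    - intros t _. now apply is_derive_laplace_primitive.
    - intros t _. apply continuity_pt_continuous. unfold q.
      apply (continuity_pt_minus (fun t => t * (Zsq t * exp (- a * t)))
        (fun t => (a ^ 2 * t - 2 * a) * exp (- a * t) * (Zsq_fejer t - t ^ 2 / 2 * l))).
      + apply continuity_pt_t_Zsq_exp.
      + apply (continuity_pt_mult (fun t => (a ^ 2 * t - 2 * a) * exp (- a * t))
          (fun t => Zsq_fejer t - t ^ 2 / 2 * l)); [reg|].
        apply (continuity_pt_minus Zsq_fejer (fun t => t ^ 2 / 2 * l)); [|reg].
        eapply is_derive_continuity_pt, is_derive_Zsq_fejer. }
  (* The main term: at 0 only [- l / a^2] survives, with [a = 2 / y]. *)
  replace (laplace_primitive a l 0) with (- (y ^ 2 / 4 * l)) in Iq.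
  2:{ unfold laplace_primitive. rewrite Zsq_int_0, Zsq_fejer_0.
      replace (- a * 0) with 0 by ring. rewrite exp_0.
      unfold a. field. lra. }
  assert (IK : is_RInt (fun t => t * (Zsq t * exp (- a * t))) 0 m (laplace_moment y)).
  { apply (RInt_correct (V := R_CompleteNormedModule)), ex_RInt_cont.
    intros t. apply continuity_pt_t_Zsq_exp. }
  set (E := C2 * 3072 * y ^ 2).
  assert (Ie : is_RInt (fun t => C2 * 3072 * y * exp (- / y * t)) 0 m
     (- E * exp (- / y * m) - - E * exp (- / y * 0))).
  { apply (is_RInt_derive (fun t => - E * exp (- / y * t))).
    - intros t _. auto_derive; [exact I|]. unfold E. field. lra.
    - intros t _. apply continuity_pt_continuous. reg. }
  assert (He : - E * exp (- / y * m) - - E * exp (- / y * 0) <= E).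
  { replace (- / y * 0) with 0 by ring. rewrite exp_0. generalize (exp_pos (- / y * m)).
    assert (0 <= E) by (unfold E; nra). nra. }
  set (e := - E * exp (- / y * m) - - E * exp (- / y * 0)) in *.
  assert (D : forall t, 0 < t < m -> Rabs (t * (Zsq t * exp (- a * t)) - q t) <= C2 * 3072 * y * exp (- / y * t)).
  { intros t Ht. unfold q.
    match goal with |- Rabs ?x <= _ => replace x with
      ((a ^ 2 * t - 2 * a) * exp (- a * t) * (Zsq_fejer t - t ^ 2 / 2 * l)) by ring end.
    rewrite !Rabs_mult, (Rabs_pos_eq (exp _)) by (apply Rlt_le, exp_pos).
    assert (A := H2 y t ltac:(lra) ltac:(lra)). fold l in A.
    assert (B := laplace_kernel_bound y t ltac:(lra) ltac:(lra)). fold a in B.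
    apply Rle_trans with (Rabs (a ^ 2 * t - 2 * a) * exp (- a * t) * (C2 * y ^ 2 * (1 + t / y) ^ 3)).
    - apply Rmult_le_compat_l; [|exact A].
      apply Rmult_le_pos; [apply Rabs_pos|apply Rlt_le, exp_pos].
    - replace (C2 * 3072 * y * exp (- / y * t)) with
       (C2 * y ^ 2 * (3072 / y * exp (- / y * t))) by (field; lra).
      replace (Rabs (a ^ 2 * t - 2 * a) * exp (- a * t) * (C2 * y ^ 2 * (1 + t / y) ^ 3)) with
       (C2 * y ^ 2 * (Rabs (a ^ 2 * t - 2 * a) * exp (- a * t) * (1 + t / y) ^ 3)) by ring.
      apply Rmult_le_compat_l; [nra|exact B]. }
  assert (Hm0 : 0 <= m) by lra.
  assert (U1 := is_RInt_le _ _ _ _ _ _ Hm0 IK (is_RInt_Rplus _ _ _ _ _ _ Iq Ie)).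
  assert (U2 := is_RInt_le _ _ _ _ _ _ Hm0 Iq (is_RInt_Rplus _ _ _ _ _ _ IK Ie)).
  cbv beta in U1, U2.
  specialize (U1 ltac:(intros t Ht; specialize (D t Ht); apply Rabs_le_between in D; lra)).
  specialize (U2 ltac:(intros t Ht; specialize (D t Ht); apply Rabs_le_between in D; lra)).
  apply Rabs_le_between in Hend.
  assert (C1 <= C1 * y ^ 2) by nra.
  unfold E in He. apply Rabs_le. lra.
Qed.

(** * The function [F] and its derivative *)

Definition laplace_Zsq (y : R) : R := RInt (fun t => Zsq t * exp (- (2 / y) * t)) 0 (mu y).

Lemma is_derive_laplace_kernel (y t : R) : 0 < y ->
  is_derive (fun u => Zsq t * exp (- (2 / u) * t)) y
    (2 / y ^ 2 * (t * (Zsq t * exp (- (2 / y) * t)))).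
Proof. intros Hy. auto_derive; [lra|]. unfold Rdiv. field. lra. Qed.

Lemma continuity_2d_laplace_kernel (y t : R) : 0 < y ->
  continuity_2d_pt (fun u v => Derive (fun z => Zsq v * exp (- (2 / z) * v)) u) y t.
Proof.
  intros Hy.
  apply continuity_2d_pt_ext_loc with (fun u v => 2 * (/ u * / u) * (v * (Zsq v * exp (- (2 * / u) * v)))).
  - exists (mkposreal y Hy). cbn. intros u v Hu _.
    apply Rabs_def2 in Hu. symmetry. apply is_derive_unique.
    replace (2 * (/ u * / u)) with (2 / u ^ 2) by (field; lra).
    apply is_derive_laplace_kernel. lra.
  - assert (I : continuity_2d_pt (fun u v => / u) y t).
    { apply continuity_2d_pt_inv; [apply continuity_2d_pt_id1|lra]. }
    assert (V := continuity_2d_pt_id2 y t).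
    apply continuity_2d_pt_mult.
    + apply continuity_2d_pt_mult; [apply continuity_2d_pt_const|].
      now apply continuity_2d_pt_mult.
    + apply continuity_2d_pt_mult; [exact V|]. apply continuity_2d_pt_mult.
      * apply (continuity_1d_2d_pt_comp Zsq (fun u v => v)); [apply Zsq_continuity|exact V].
      * apply (continuity_1d_2d_pt_comp exp (fun u v => - (2 * / u) * v)).
        { apply derivable_continuous, derivable_exp. }
        apply continuity_2d_pt_mult; [|exact V]. apply continuity_2d_pt_opp.
        apply continuity_2d_pt_mult; [apply continuity_2d_pt_const|exact I].
Qed.

Lemma locally_pos (y : R) : 0 < y -> locally y (fun u => 0 < u).
Proof.
  intros Hy. exists (mkposreal y Hy). intros u Hu.
  apply Rabs_def2 in Hu. cbn in Hu. unfold minus, plus, opp in Hu; cbn in Hu. lra.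
Qed.

(** Leibniz rule: the first summand differentiates the weight, the second the endpoint, with
    [mu' = 7 ln y + 7]. *)
Lemma is_derive_laplace_Zsq (y : R) : 0 < y ->
  is_derive laplace_Zsq y
    (2 / y ^ 2 * laplace_moment y + Zsq (mu y) * exp (- (2 / y) * mu y) * (7 * ln y + 7)).
Proof.
  intros Hy.
  assert (EX : forall u a b, ex_RInt (fun t => Zsq t * exp (- (2 / u) * t)) a b).
  { intros u a b. apply ex_RInt_cont. intros t. apply continuity_pt_Zsq_exp. }
  replace (2 / y ^ 2 * laplace_moment y) with
    (RInt (fun t => Derive (fun u => Zsq t * exp (- (2 / u) * t)) y) 0 (mu y)).
  2:{ apply is_RInt_unique.
      apply (is_RInt_Rext (fun t => 2 / y ^ 2 * (t * (Zsq t * exp (- (2 / y) * t))))).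
      - intros t. symmetry. apply is_derive_unique, is_derive_laplace_kernel, Hy.
      - apply is_RInt_Rscal. apply (RInt_correct (V := R_CompleteNormedModule)), ex_RInt_cont.
        intros t. apply continuity_pt_t_Zsq_exp. }
  apply (is_derive_RInt_param_bound_comp_aux3 (fun u t => Zsq t * exp (- (2 / u) * t)) 0 mu y).
  - apply filter_forall. intros u. apply EX.
  - exists (mkposreal 1 Rlt_0_1). apply filter_forall. intros u. apply EX.
  - unfold mu. auto_derive; [lra|]. field. lra.
  - exists (mkposreal 1 Rlt_0_1). generalize (locally_pos y Hy). apply filter_imp.
    intros u Hu t _. eexists. now apply is_derive_laplace_kernel.
  - intros t _. now apply continuity_2d_laplace_kernel.
  - exists (mkposreal y Hy). cbn. intros u v Hu _. apply Rabs_def2 in Hu.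
    apply continuity_2d_laplace_kernel. lra.
  - apply continuity_pt_Zsq_exp.
Qed.

(** The endpoint term is bounded, since [Zsq (mu y) = O(y^6)] and [mu' <= 7 y] meet the weight
    [y^{-14}]; [10^9] is twice its bound. *)
Lemma laplace_Zsq_slope : exists C Y (d : R -> R), 0 < C /\ 7 <= Y /\ forall y, Y <= y ->
  is_derive laplace_Zsq y (d y) /\ Rabs (2 * d y - ln y) <= C.
Proof.
  destruct laplace_moment_asymp as [C [Y [HC [HY H]]]].
  exists (4 * C + 10 ^ 9), Y, (fun y => 2 / y ^ 2 * laplace_moment y +
    Zsq (mu y) * exp (- (2 / y) * mu y) * (7 * ln y + 7)).
  split; [lra|]. split; [exact HY|]. intros y Hy.
  split; [apply is_derive_laplace_Zsq; lra|].
  assert (Hm := mu_bounds y ltac:(lra)).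
  rewrite exp_mu by lra.
  assert (B : 0 <= Zsq (mu y) * / y ^ 14 * (7 * ln y + 7) <= 5 * 10 ^ 8).
  { assert (L := ln_le_self y ltac:(lra)). assert (L1 := one_le_ln3 y ltac:(lra)).
    assert (Z0 := Zsq_nonneg (mu y)). assert (Z := Zsq_le_pow2 (mu y) ltac:(lra)).
    assert (P : forall k, 0 < y ^ k) by (intros; apply pow_lt; lra).
    assert (I : 0 < / y ^ 14) by (apply Rinv_0_lt_compat, P).
    split; [apply Rmult_le_pos; [apply Rmult_le_pos|]; lra|].
    assert (Z' : Zsq (mu y) <= 2529 ^ 2 * (4 * y ^ 6)).
    { eapply Rle_trans; [exact Z|]. apply Rmult_le_compat_l; [lra|].
      replace (4 * y ^ 6) with ((2 * y ^ 3) ^ 2) by ring. apply pow_incr.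
      assert (1 <= y ^ 3) by (apply pow_R1_Rle; lra). lra. }
    apply (Rmult_le_reg_r (y ^ 14)); [apply P|].
    replace (Zsq (mu y) * / y ^ 14 * (7 * ln y + 7) * y ^ 14) with (Zsq (mu y) * (7 * ln y + 7))
      by (field; generalize (P 14%nat); lra).
    apply Rle_trans with (2529 ^ 2 * (4 * y ^ 6) * (7 * y)).
    - apply Rmult_le_compat; lra.
    - replace (2529 ^ 2 * (4 * y ^ 6) * (7 * y)) with (2529 ^ 2 * 28 * y ^ 7) by ring.
      apply Rmult_le_compat; try lra; [apply Rlt_le, P|]. apply Rle_pow; [lra|lia]. }
  set (b := Zsq (mu y) * / y ^ 14 * (7 * ln y + 7)) in *.
  assert (A := H y Hy).
  replace (2 * (2 / y ^ 2 * laplace_moment y + b) - ln y) with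
    (4 / y ^ 2 * (laplace_moment y - y ^ 2 / 4 * ln y) + 2 * b) by (field; lra).
  eapply Rle_trans; [apply Rabs_triang|].
  rewrite Rabs_mult, (Rabs_pos_eq (2 * b)) by lra.
  assert (I : 0 < 4 / y ^ 2) by (apply Rdiv_lt_0_compat; nra).
  rewrite (Rabs_pos_eq (4 / y ^ 2)) by lra.
  apply (Rmult_le_compat_l (4 / y ^ 2)) in A; [|lra].
  replace (4 / y ^ 2 * (C * y ^ 2)) with (4 * C) in A by (field; lra). lra.
Qed.

(** * Comparison of [ln phi(T)] with [ln T], and the theorem *)

Lemma laplace_Zsq_bounds (y : R) : 7 <= y -> Zsq_int y <= 9 * laplace_Zsq y /\ laplace_Zsq y <= Zsq_int (mu y).
Proof.
  intros Hy. assert (Hm := mu_bounds y Hy).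
  set (f := fun t => Zsq t * exp (- (2 / y) * t)).
  assert (Cf : forall t, continuity_pt f t) by (intros; apply continuity_pt_Zsq_exp).
  assert (If : forall b, is_RInt f 0 b (RInt f 0 b)).
  { intros b. apply (RInt_correct (V := R_CompleteNormedModule)), ex_RInt_cont, Cf. }
  assert (Hiy : 0 < 2 / y) by (apply Rdiv_lt_0_compat; lra).
  split.
  - apply Rle_trans with (9 * RInt f 0 y).
    + assert (Hy0 : 0 <= y) by lra.
      apply (is_RInt_le _ _ _ _ _ _ Hy0 (Zsq_int_correct y) (is_RInt_Rscal _ _ _ 9 _ (If y))).
      intros t Ht. unfold f.
      (* Up to [t = y] the weight is at least [e^{-2}], and [e <= 3]. *)
      assert (E : / 9 <= exp (- (2 / y) * t)).
      { apply Rle_trans with (exp (- (1 + 1))).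
        - rewrite exp_Ropp, exp_plus. apply Rinv_le_contravar; [generalize (exp_pos 1); nra|].
          generalize exp_le_3 (exp_pos 1); nra.
        - assert (2 / y * t <= 2).
          { replace 2 with (2 / y * y) at 2 by (field; lra). apply Rmult_le_compat_l; lra. }
          destruct (Rle_lt_or_eq_dec (- (1 + 1)) (- (2 / y) * t)) as [H'|H'];
            [lra|left; now apply exp_increasing|rewrite H'; lra]. }
      generalize (Zsq_nonneg t); nra.
    + apply Rmult_le_compat_l; [lra|].
      apply (nondecreasing_of_derive_nonneg (fun b => RInt f 0 b) f); [lra| |].
      * intros x. now apply is_derive_RInt_cont.
      * intros x _. apply Rmult_le_pos; [apply Zsq_nonneg|apply Rlt_le, exp_pos].
  - assert (Hm0 : 0 <= mu y) by lra.
    apply (is_RInt_le _ _ _ _ _ _ Hm0 (If (mu y)) (Zsq_int_correct (mu y))).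
    intros t Ht. unfold f. rewrite <- (Rmult_1_r (Zsq t)) at 2.
    apply Rmult_le_compat_l; [apply Zsq_nonneg|].
    rewrite <- exp_0. left; apply exp_increasing. nra.
Qed.

(** The sandwich gives [y <= 9 C S ln S] in one direction. In the other it gives
    [S <= 21 C y (ln y)^2], one logarithm coming from [mu] and one from the upper bound for
    [Zsq_int]. With [ln y <= 3 ln S] the latter constant becomes [189 = 21 * 9]. *)
Lemma ladder_log_close : exists C X1, 0 < C /\ forall y S, X1 <= y -> X1 <= S ->
  laplace_Zsq y = Zsq_int S -> Rabs (ln y - ln S) <= C + 2 * ln (ln S).
Proof.
  destruct Zsq_int_bounds as [C [X0 [HC [HX0 H]]]].
  set (X1 := Rmax X0 (9 * C) + 7).
  assert (R1 := Rmax_l X0 (9 * C)). assert (R2 := Rmax_r X0 (9 * C)).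
  assert (L9 : ln (9 * C) <= 9 * C) by (generalize (ln_le_self (9 * C)); lra).
  assert (L189 : ln (189 * C) <= 189 * C) by (generalize (ln_le_self (189 * C)); lra).
  exists (189 * C), X1. split; [lra|]. intros y S Hy HS E. unfold X1 in *.
  assert (Hm := mu_bounds y ltac:(lra)).
  destruct (laplace_Zsq_bounds y ltac:(lra)) as [B1 B2]. rewrite E in B1, B2.
  assert (My := H y ltac:(lra)). assert (MS := H S ltac:(lra)). assert (Mm := H (mu y) ltac:(lra)).
  assert (LS := one_le_ln3 S ltac:(lra)). assert (LS' := ln_le_self S ltac:(lra)).
  assert (Ly := one_le_ln3 y ltac:(lra)).
  assert (LLS : 0 <= ln (ln S)) by (rewrite <- ln_1; apply ln_le; lra).
  assert (U : y <= 9 * C * (S * ln S)) by lra.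
  assert (U1 : ln y <= ln (9 * C) + (ln S + ln (ln S))).
  { rewrite <- !ln_mult by nra. apply ln_le; lra. }
  assert (U3 : ln y <= 3 * ln S).
  { replace (3 * ln S) with (ln S + (ln S + ln S)) by ring. rewrite <- !ln_mult by nra.
    apply ln_le; [lra|]. eapply Rle_trans; [exact U|]. apply Rmult_le_compat; nra. }
  assert (Lm : ln (mu y) <= 3 * ln y).
  { replace (3 * ln y) with (ln y + (ln y + ln y)) by ring. rewrite <- !ln_mult by nra.
    apply ln_le; [lra|]. replace (y * (y * y)) with (y ^ 3) by ring. lra. }
  assert (V : S <= 189 * C * (y * (ln S * ln S))).
  { apply Rle_trans with (C * mu y * (3 * ln y)).
    - apply Rle_trans with (C * mu y * ln (mu y)); [lra|]. apply Rmult_le_compat_l; nra.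
    - unfold mu. replace (C * (7 * y * ln y) * (3 * ln y)) with (21 * (C * y) * (ln y * ln y)) by ring.
      replace (189 * C * (y * (ln S * ln S))) with (21 * (C * y) * ((3 * ln S) * (3 * ln S))) by ring.
      apply Rmult_le_compat_l; [nra|]. apply Rmult_le_compat; lra. }
  assert (V1 : ln S <= ln (189 * C) + (ln y + (ln (ln S) + ln (ln S)))).
  { rewrite <- !ln_mult by (repeat apply Rmult_lt_0_compat; lra). apply ln_le; lra. }
  apply Rabs_le. lra.
Qed.

Theorem mainTheorem1 (phi : R -> R) (Hphi : is_jacobs_ladder phi) :
  exists C T1 : R, 0 < C /\
    forall T U : R, T1 <= T -> 0 < U -> U <= T / ln T ->
      exists eps : R,
        Rabs eps <= C * (ln (ln T) / ln T) /\
        Rint Zsq T (T + U) = U * ln T * tan_alpha phi T U * (1 + eps).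
Proof.
  destruct Hphi as [T0 [_ [Hincr [Hinf Heq]]]].
  destruct laplace_Zsq_slope as [C [Y [d [HC [HY Hd]]]]].
  destruct ladder_log_close as [c [X1 [Hc Hlog]]].
  destruct (Hinf (Rmax Y X1)) as [T2 HT2].
  (* Beyond [exp (exp 1)] one has [ln (ln T) >= 1], so additive constants can be absorbed. *)
  set (T1 := Rmax (exp (exp 1)) (Rmax X1 (Rmax T0 T2)) + 3).
  exists (C + c + 5), T1. split; [lra|]. intros T U HT HU HUT.
  assert (Y1 := Rmax_l Y X1). assert (Y2 := Rmax_r Y X1).
  assert (M1 := Rmax_l (exp (exp 1)) (Rmax X1 (Rmax T0 T2))).
  assert (M2 := Rmax_r (exp (exp 1)) (Rmax X1 (Rmax T0 T2))).
  assert (M3 := Rmax_l X1 (Rmax T0 T2)). assert (M4 := Rmax_r X1 (Rmax T0 T2)).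
  assert (M5 := Rmax_l T0 T2). assert (M6 := Rmax_r T0 T2).
  assert (E1 := exp_pos (exp 1)).
  unfold T1 in HT.
  assert (HL := one_le_ln3 T ltac:(lra)).
  assert (HLL : 1 <= ln (ln T)).
  { assert (exp 1 <= ln T).
    { rewrite <- (ln_exp (exp 1)). apply ln_le; lra. }
    rewrite <- (ln_exp 1). apply ln_le; [apply exp_pos|lra]. }
  assert (HU2 : U <= T).
  { eapply Rle_trans; [exact HUT|]. apply (Rmult_le_reg_r (ln T)); [lra|].
    unfold Rdiv. rewrite Rmult_assoc, Rinv_l by lra. nra. }
  assert (Hlad : forall S, T <= S -> laplace_Zsq (phi S) = Zsq_int S).
  { intros S HS. specialize (Heq S ltac:(lra)).
    rewrite !Rint_RInt in Heq; [exact Heq| |]; apply ex_RInt_cont.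
    - apply Zsq_continuity.
    - intros t. apply continuity_pt_Zsq_exp. }
  assert (P1 := HT2 T ltac:(lra)). assert (P2 := HT2 (T + U) ltac:(lra)).
  assert (Pi := Hincr T (T + U) ltac:(lra) ltac:(lra)).
  assert (G1 := Hlog (phi T) T ltac:(lra) ltac:(lra) (Hlad T ltac:(lra))).
  assert (G2 := Hlog (phi (T + U)) (T + U) ltac:(lra) ltac:(lra) (Hlad (T + U) ltac:(lra))).
  apply Rabs_le_between in G1, G2.
  destruct (MVT_gen laplace_Zsq (phi T) (phi (T + U)) d) as [xi [Hxi Emvt]].
  { intros y Hy. rewrite Rmin_left in Hy by lra. apply Hd. lra. }
  { intros y Hy. rewrite Rmin_left in Hy by lra.
    eapply is_derive_continuity_pt, Hd. lra. }
  rewrite Rmin_left, Rmax_right in Hxi by lra.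
  rewrite !Hlad in Emvt by lra.
  destruct (Hd xi ltac:(lra)) as [_ Hs]. apply Rabs_le_between in Hs.
  assert (L1 : ln (phi T) <= ln xi) by (apply ln_le; lra).
  assert (L2 : ln xi <= ln (phi (T + U))) by (apply ln_le; lra).
  assert (H2 : ln 2 <= 1) by (generalize (ln_le_self 2); lra).
  assert (L3 : ln (T + U) <= 1 + ln T).
  { apply Rle_trans with (ln (2 * T)); [apply ln_le; lra|]. rewrite ln_mult by lra. lra. }
  assert (L4 : ln (ln (T + U)) <= 1 + ln (ln T)).
  { apply Rle_trans with (ln (2 * ln T)).
    - apply ln_le; [|lra]. generalize (one_le_ln3 (T + U)); lra.
    - rewrite ln_mult by lra. lra. }
  (* Since [U * tan_alpha phi T U] is half the increment of [phi], the factor [1 + eps] must be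
     [2 F'(xi) / ln T]. *)
  exists (2 * d xi / ln T - 1). split.
  - replace (2 * d xi / ln T - 1) with ((2 * d xi - ln T) * / ln T) by (field; lra).
    assert (0 < / ln T) by (apply Rinv_0_lt_compat; lra).
    rewrite Rabs_mult, (Rabs_pos_eq (/ ln T)) by lra.
    unfold Rdiv. rewrite <- Rmult_assoc. apply Rmult_le_compat_r; [lra|].
    (* The deviation is at most [C + c + 3 + 2 ln (ln T)]; the 3 is the cost of replacing [T + U] by
       [T], once in [ln] and twice in [ln ln]. *)
    assert ((C + c + 3) * 1 <= (C + c + 3) * ln (ln T)) by (apply Rmult_le_compat_l; lra).
    apply Rabs_le. lra.
  - rewrite Rint_RInt by (apply ex_RInt_cont, Zsq_continuity).
    assert (CH : Zsq_int T + RInt Zsq T (T + U) = Zsq_int (T + U)).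
    { apply (RInt_Chasles (V := R_CompleteNormedModule) Zsq 0 T (T + U));
        apply ex_RInt_cont, Zsq_continuity. }
    replace (RInt Zsq T (T + U)) with (d xi * (phi (T + U) - phi T)) by (rewrite <- Emvt, <- CH; ring).
    unfold tan_alpha. field. lra.
Qed.
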